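(* Let $n\ge1$, $m\ge0$. There is a smooth map $\widehat\Phi_{n,m}:\mathbb{R}^n\times D^m\to\mathbb{D}^{n,m}$ which is a homeomorphism, satisfies $\widehat\Phi_{n,m}(\mathbb{S}^{n-1}\times D^m)=\mathbb{S}^{n-1,m}$ and $\widehat\Phi_{n,m}(S^{n-1}\times D^m)=\partial_0\mathbb{S}^{n-1,m}$, and whose restriction $(\mathbb{R}^n\times D^m)\smallsetminus(S^{n-1}\times D^m)\to\mathbb{D}^{n,m}\smallsetminus\partial_0\mathbb{S}^{n-1,m}$ is a diffeomorphism. Consequently the pair $(\mathbb{R}^n\times D^m,\ \mathbb{S}^{n-1}\times D^m)$ has the topological homotopy type of $(D^n,S^{n-1})$.
   Context: Let $\ell(t)=0$ for $t\le0$, $\ell(t)=e^{-1/t}$ for $t>0$; $\alpha_0=\int_0^1\ell(3x)\ell(3-3x)\,dx$; $\lambda(t)=\frac1{\alpha_0}\int_0^t\ell(3x)\ell(3-3x)\,dx$; $\phi(t)=\int_0^{1/2+t}\lambda(x)\,dx$. $\|\cdot\|$ is the Euclidean norm. $\mathbb{D}^{n,m}=\{(u,v)\in\mathbb{R}^n\times\mathbb{R}^m:\|u\|\ge1-\phi(2-\|u\|-\|v\|)\}$; $\mathbb{S}^{n-1}=\{u\in\mathbb{R}^n:\|u\|\ge1\}$; $S^{n-1}=\{u:\|u\|=1\}$; $D^m=\{v\in\mathbb{R}^m:\|v\|\le1\}$; $\mathbb{S}^{n-1,m}=\{(u,v)\in\mathbb{R}^n\times\mathbb{R}^m:\|u\|\ge1\}$;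 $\partial_0\mathbb{S}^{n-1,m}=\{(u,v):\|u\|=1,\ \|v\|\le 3/2\}$. All subsets of Euclidean spaces carry the subset diffeology (smooth = smooth into the ambient Euclidean space). *)

(* Defs.v *)
From HB Require Import structures.
From mathcomp Require Import all_boot all_order all_algebra.
From mathcomp Require Import all_classical all_reals all_analysis.
Set Implicit Arguments. Unset Strict Implicit. Unset Printing Implicit Defensive.
Import Order.TTheory GRing.Theory Num.Theory.
Import numFieldNormedType.Exports.
Local Open Scope classical_set_scope.
Local Open Scope ring_scope.

Section Defs.
Variable R : realType.

Definition oint (a b : R) (f : R -> R) : R :=
  if a <= b then Rintegral (@lebesgue_measure R) [set x : R | a <= x <= b] f
  else - Rintegral (@lebesgue_measure R) [set x : R | b <= x <= a] f.

Definition ell (t : R) : R := if t <= 0 then 0 else expR (- t^-1).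
Definition bump (x : R) : R := ell (3 * x) * ell (3 - 3 * x).
Definition alpha0 : R := oint 0 1 bump.
Definition lam (t : R) : R := alpha0^-1 * oint 0 t bump.
Definition phi (t : R) : R := oint 0 (2^-1 + t) lam.

Definition enorm (k : nat) (u : 'rV[R]_k) : R :=
  Num.sqrt (\sum_(i < k) u ord0 i ^+ 2).

(** Points of R^n x R^m are rows x : 'rV_(n+m), with u = lsubmx x, v = rsubmx x. *)
Definition DD (n m : nat) : set 'rV[R]_(n + m) :=
  [set x | 1 - phi (2 - enorm (lsubmx x) - enorm (rsubmx x)) <= enorm (lsubmx x)].
Definition RnDm (n m : nat) : set 'rV[R]_(n + m) :=
  [set x | enorm (rsubmx x) <= 1].
Definition SSxDm (n m : nat) : set 'rV[R]_(n + m) :=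
  [set x | 1 <= enorm (lsubmx x) /\ enorm (rsubmx x) <= 1].
Definition SxDm (n m : nat) : set 'rV[R]_(n + m) :=
  [set x | enorm (lsubmx x) = 1 /\ enorm (rsubmx x) <= 1].
Definition SSnm (n m : nat) : set 'rV[R]_(n + m) :=
  [set x | 1 <= enorm (lsubmx x)].
Definition d0SSnm (n m : nat) : set 'rV[R]_(n + m) :=
  [set x | enorm (lsubmx x) = 1 /\ enorm (rsubmx x) <= 3 / 2].
Definition Disk (n : nat) : set 'rV[R]_n := [set u | enorm u <= 1].
Definition Sphere (n : nat) : set 'rV[R]_n := [set u | enorm u = 1].

Fixpoint smoothk (d l : nat) (k : nat) (U : set 'rV[R]_d)
  (f : 'rV[R]_d -> 'rV[R]_l) : Prop :=
  match k with
  | O => {within U, continuous f}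
  | k'.+1 => (forall x v, U x -> derivable f x v) /\
             (forall v, smoothk k' U (fun x => 'D_v f x))
  end.
Definition smooth_on (d l : nat) (U : set 'rV[R]_d) (f : 'rV[R]_d -> 'rV[R]_l) :=
  forall k, smoothk k U f.

(** Smoothness of a map defined on a subset A of R^k, for the subset diffeology:
    it sends every plot of A (smooth map from an open subset of some R^d
    with image in A) to a smooth map into R^l. *)
Definition dsmooth (k l : nat) (A : set 'rV[R]_k) (f : 'rV[R]_k -> 'rV[R]_l) :=
  forall (d : nat) (U : set 'rV[R]_d) (p : 'rV[R]_d -> 'rV[R]_k),
    open U -> smooth_on U p -> p @` U `<=` A -> smooth_on U (f \o p).

Definition homeo (k l : nat) (A : set 'rV[R]_k) (B : set 'rV[R]_l)
  (f : 'rV[R]_k -> 'rV[R]_l) :=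
  exists g : 'rV[R]_l -> 'rV[R]_k,
    [/\ f @` A `<=` B, g @` B `<=` A,
        (forall x, A x -> g (f x) = x), (forall y, B y -> f (g y) = y) &
        {within A, continuous f} /\ {within B, continuous g}].

Definition diffeo (k l : nat) (A : set 'rV[R]_k) (B : set 'rV[R]_l)
  (f : 'rV[R]_k -> 'rV[R]_l) :=
  exists g : 'rV[R]_l -> 'rV[R]_k,
    [/\ f @` A `<=` B, g @` B `<=` A,
        (forall x, A x -> g (f x) = x), (forall y, B y -> f (g y) = y) &
        dsmooth A f /\ dsmooth B g].

Definition pair_map (k l : nat) (X A : set 'rV[R]_k) (Y B : set 'rV[R]_l)
  (f : 'rV[R]_k -> 'rV[R]_l) :=
  [/\ {within X, continuous f}, f @` X `<=` Y & f @` A `<=` B].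

Definition pair_homotopic (k l : nat) (X A : set 'rV[R]_k) (Y B : set 'rV[R]_l)
  (f g : 'rV[R]_k -> 'rV[R]_l) :=
  exists H : R * 'rV[R]_k -> 'rV[R]_l,
    [/\ {within [set p | 0 <= p.1 <= 1 /\ X p.2], continuous H},
        (forall x, X x -> H (0, x) = f x /\ H (1, x) = g x),
        (forall t x, 0 <= t <= 1 -> X x -> Y (H (t, x))) &
        (forall t x, 0 <= t <= 1 -> A x -> B (H (t, x)))].

Definition pair_homotopy_equivalent (k l : nat) (X A : set 'rV[R]_k)
  (Y B : set 'rV[R]_l) :=
  exists (f : 'rV[R]_k -> 'rV[R]_l) (g : 'rV[R]_l -> 'rV[R]_k),
    [/\ pair_map X A Y B f, pair_map Y B X A g,
        pair_homotopic X A X A (g \o f) id &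
        pair_homotopic Y B Y B (f \o g) id].

End Defs.

Arguments DD R n m : clear implicits.
Arguments RnDm R n m : clear implicits.
Arguments SSxDm R n m : clear implicits.
Arguments SxDm R n m : clear implicits.
Arguments SSnm R n m : clear implicits.
Arguments d0SSnm R n m : clear implicits.
Arguments Disk R n : clear implicits.
Arguments Sphere R n : clear implicits.

(* Main.v *)
(** Writing [r = |u|] and [s = |v|], the map sends [(u, v)] to
    [(X(r, s) / r * u, H(r) * v)].  For [r <= 1] a parameter [t] running from [1]
    to [-1/2] gives [X = 1 - phi t] and [H = 1 + phi (- t)], so that, since
    [phi t - phi (- t) = t], the boundary [s = 1] is carried to the curve
    [X + phi (2 - X - H) = 1] bounding the domain.  For [r >= 1] a parameter [a >= 0]
    gives [X = 1 + a (1 - s^2)] and [H^2 = 9/4 + a], whose level curves [r = const]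
    are parabolic arcs ending on [X = 1]; the inverse only needs the root of a
    quadratic equation, whose discriminant vanishes only at [(X, Y) = (1, 3/2)],
    where [Y = s H].  Taking [t = phi (3/2 - 2r) - 1/2] and [a = phi (r - 3/2)], both
    of which are constant on one side of [r = 1] and flat there, the two formulas
    glue to a smooth map.  The inverse is expressed with the inverse function of
    [phi], which is smooth on positive reals.  Only one-variable chain rules are
    needed, because smoothness along a plot can be tested on the coordinates. *)

Require Import Defs.
From HB Require Import structures.
From mathcomp Require Import all_boot all_order all_algebra.
From mathcomp Require Import all_classical all_reals all_analysis.
From mathcomp Require Import ring lra.
Import Order.TTheory GRing.Theory Num.Theory.
Import numFieldNormedType.Exports.
Local Open Scope classical_set_scope.
Local Open Scope ring_scope.

Set Implicit Arguments.
Unset Strict Implicit.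
Unset Printing Implicit Defensive.

(** * Germs of C^k functions *)

Section GermCalculus.
Context {R : realType}.

(* [D] is the set of directions of differentiation: all vectors along a plot,
   [1] alone for functions of one real variable. *)
Fixpoint Ck_at (E : normedModType R) (D : set E) (k : nat) (x : E)
    (f : E -> R) : Prop :=
  match k with
  | O => {for x, continuous f}
  | k'.+1 => {for x, continuous f} /\ exists f' : E -> E -> R, forall v, D v ->
      (\forall y \near x, is_derive y v f (f' v y)) /\ Ck_at D k' x (f' v)
  end.

Lemma near_eq_continuous_at (T U : topologicalType) (f g : T -> U) (x : T) :
  (\forall y \near x, f y = g y) -> {for x, continuous f} ->
  {for x, continuous g}.
Proof.
move=> fg cf; change (g @ x --> g x); rewrite -(nbhs_singleton fg).
by apply: cvg_trans cf; apply: near_eq_cvg.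
Qed.

(** Both sides are limits of the same difference quotient. This reduces directional derivatives to
    derivatives in one real variable. *)
Lemma is_derive_line (E : normedModType R) (f : E -> R) (x v : E) (df : R) :
  is_derive x v f df <-> is_derive (0 : R) (1 : R) (fun h : R => f (h *: v + x)) df.
Proof.
have eD : 'D_(1 : R) (fun h : R => f (h *: v + x)) 0 = 'D_v f x.
  rewrite /derive; set g1 := fun h => h^-1 *: _; set g2 := fun h => h^-1 *: _.
  suff -> : g1 = g2 by [].
  by apply/funext => h; rewrite /g1 /g2 /= addr0 scale0r add0r [_%:A]mulr1.
split=> -[fd <-].
  by rewrite -eD; apply: DeriveDef => //; exact: (iffLR (derivable1P f x v)).
by rewrite eD; apply: DeriveDef => //; exact: (iffRL (derivable1P f x v)).
Qed.

Lemma is_derive_compl (E : normedModType R) (phi : R -> R) (f : E -> R)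
    (x v : E) (a b : R) :
  is_derive (f x) (1 : R) phi a -> is_derive x v f b ->
  is_derive x v (phi \o f) (a * b).
Proof.
move=> dphi /is_derive_line df; apply/is_derive_line.
apply: (@is_derive1_comp _ phi (fun h : R => f (h *: v + x))).
by rewrite scale0r add0r.
Qed.

(** * Closure of C^k germs under arithmetic and composition *)

Section ScalarGerms.
Context {E : normedModType R} {D : set E}.
Implicit Types (f g : E -> R) (x : E) (k : nat).

Lemma Ck_at_near_eq k x f g :
  (\forall y \near x, f y = g y) -> Ck_at D k x f -> Ck_at D k x g.
Proof.
elim: k f g => [|k IH] f g fg; first exact: near_eq_continuous_at.
move=> [cf [f' f'P]]; split; first exact: near_eq_continuous_at cf.
exists f' => v Dv; have [dv sv] := f'P v Dv; split=> //.
(* A derivative at [y] needs equality on a whole neighbourhood of [y], not only at [y]. *)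
have fgn := nbhs_interior fg.
near=> y; apply: (@near_eq_is_derive _ _ _ f); last by near: y.
by near: y.
Unshelve. all: by end_near. Qed.

Lemma Ck_atW k x f : Ck_at D k.+1 x f -> Ck_at D k x f.
Proof.
elim: k f => [|k IH] f [cf [f' f'P]] //; split=> //.
by exists f' => v Dv; have [dv sv] := f'P v Dv; split=> //; exact: IH.
Qed.

Lemma Ck_at_cst k x (c : R) : Ck_at D k x (fun=> c).
Proof.
elim: k c => [|k IH] c; first exact: cst_continuous.
split; first exact: cst_continuous.
exists (fun _ _ => 0) => v Dv; split; last exact: IH.
by near=> y; exact: is_derive_cst.
Unshelve. all: by end_near. Qed.

Lemma Ck_atD k x f g : Ck_at D k x f -> Ck_at D k x g ->
  Ck_at D k x (fun y => f y + g y).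
Proof.
elim: k f g => [|k IH] f g; first exact: continuousD.
move=> [cf [f' f'P]] [cg [g' g'P]]; split; first exact: continuousD.
exists (fun v y => f' v y + g' v y) => v Dv.
have [dfv sf] := f'P v Dv; have [dgv sg] := g'P v Dv; split; last exact: IH.
by near=> y; apply: is_deriveD; near: y.
Unshelve. all: by end_near. Qed.

(** The Leibniz formula contains the factors themselves beside their derivatives, so [Ck_atW] lowers
    their order before the induction hypothesis is used. *)
Lemma Ck_atM k x f g : Ck_at D k x f -> Ck_at D k x g ->
  Ck_at D k x (fun y => f y * g y).
Proof.
elim: k f g => [|k IH] f g; first exact: continuousM.
move=> sf sg; move: (sf) (sg) => [cf [f' f'P]] [cg [g' g'P]].
split; first exact: continuousM.
exists (fun v y => f y * g' v y + g y * f' v y) => v Dv.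
have [dfv sf'] := f'P v Dv; have [dgv sg'] := g'P v Dv; split; last first.
  by apply: Ck_atD; apply: IH => //; exact: Ck_atW.
by near=> y; apply: is_deriveM; near: y.
Unshelve. all: by end_near. Qed.

Lemma Ck_atZ k x (c : R) f : Ck_at D k x f -> Ck_at D k x (fun y => c * f y).
Proof. exact/Ck_atM/Ck_at_cst. Qed.

Lemma Ck_atN k x f : Ck_at D k x f -> Ck_at D k x (fun y => - f y).
Proof.
move=> /(Ck_atZ (-1)); apply: Ck_at_near_eq.
by near=> y; rewrite mulN1r.
Unshelve. all: by end_near. Qed.

Lemma Ck_atB k x f g : Ck_at D k x f -> Ck_at D k x g ->
  Ck_at D k x (fun y => f y - g y).
Proof. by move=> sf /Ck_atN; exact: Ck_atD. Qed.

Lemma Ck_at_sum k x n (f : 'I_n -> E -> R) :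
  (forall i, Ck_at D k x (f i)) -> Ck_at D k x (fun y => \sum_(i < n) f i y).
Proof.
elim: n f => [|n IH] f sf.
  apply: Ck_at_near_eq (Ck_at_cst k x 0).
  by near=> y; rewrite big_ord0.
apply: Ck_at_near_eq (Ck_atD (IH (f \o lift ord0) _) (sf ord0)) => [|i].
  by near=> y; rewrite big_ord_recl addrC.
exact: sf.
Unshelve. all: by end_near. Qed.

Lemma Ck_at_comp k x (phi : R -> R) f :
  Ck_at [set (1 : R)] k (f x) phi -> Ck_at D k x f -> Ck_at D k x (phi \o f).
Proof.
elim: k phi f => [|k IH] phi f.
  by move=> cphi cf; exact: continuous_comp.
move=> [cphi [p' p'P]] sf; move: (sf) => [cf [f' f'P]].
split; first exact: continuous_comp.
have [dp sp] := p'P 1 erefl.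
exists (fun v y => p' 1 (f y) * f' v y) => v Dv.
have [df sf'] := f'P v Dv; split; last first.
  by apply: Ck_atM => //; apply: IH => //; exact: Ck_atW.
(* The outer function is differentiable near [f x]; continuity of [f] pulls this neighbourhood back
   to [x]. *)
have dpf : \forall y \near x, is_derive (f y) (1 : R) phi (p' 1 (f y)).
  exact: (cf _ dp).
by near=> y; apply: is_derive_compl; near: y.
Unshelve. all: by end_near. Qed.

End ScalarGerms.

Lemma Ck_at_id k (x : R) : Ck_at [set (1 : R)] k x id.
Proof.
case: k => [|k]; first exact: cvg_id.
split; first exact: cvg_id.
exists (fun _ _ => 1) => v ->; split; last exact: Ck_at_cst.
by near=> y; exact: is_derive_id.
Unshelve. all: by end_near. Qed.

(** The direction 1 is the only one here, so one derivative function suffices, and continuity at [x]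
    follows from differentiability. *)
Lemma Ck_at_deriveS k (x : R) (f f' : R -> R) :
  (\forall y \near x, is_derive y (1 : R) f (f' y)) -> Ck_at [set (1 : R)] k x f' ->
  Ck_at [set (1 : R)] k.+1 x f.
Proof.
move=> df sf'; split; last by exists (fun=> f') => v ->.
have [dx _] := nbhs_singleton df.
exact/differentiable_continuous/derivable1_diffP.
Qed.

(** The derivative is a polynomial in the inverse itself, so the order rises by induction. *)
Lemma Ck_at_inv k (x : R) : x != 0 -> Ck_at [set (1 : R)] k x GRing.inv.
Proof.
elim: k x => [|k IH] x x0; first exact: inv_continuous.
apply: (@Ck_at_deriveS _ _ _ (fun y => - (y^-1 * y^-1))).
  have xn : \forall y \near x, y != 0.
    by have := @open_neq R 0; rewrite openE; apply.
  near=> y; have y0 : y != 0 by near: y.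
  apply: (is_derive_eq (is_deriveV (f := id) y0 (is_derive_id _ _))).
  by rewrite /GRing.scale/= mulr1 -exprVn expr2.
by apply/Ck_atN/Ck_atM; exact: IH.
Unshelve. all: by end_near. Qed.

Lemma Ck_at_sqrt k (x : R) : 0 < x -> Ck_at [set (1 : R)] k x Num.sqrt.
Proof.
elim: k x => [|k IH] x x0; first exact: sqrt_continuous.
apply: (@Ck_at_deriveS _ _ _ (fun y => (2 * Num.sqrt y)^-1)).
  have xn : \forall y \near x, 0 < y by exact: lt_nbhsr.
  by near=> y; apply: is_derive1_sqrt; near: y.
apply: (@Ck_at_comp R _ k x GRing.inv (fun y => 2 * Num.sqrt y)).
  by apply: Ck_at_inv; rewrite mulf_neq0 // gt_eqF // sqrtr_gt0.
exact/Ck_atZ/IH.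
Unshelve. all: by end_near. Qed.

(** Neighbourhoods of a matrix are generated by products of neighbourhoods of its finitely many
    entries. *)
Lemma matrix_continuousP (T : topologicalType) m n (F : T -> 'M[R]_(m, n)) x :
  {for x, continuous F} <-> forall i j, {for x, continuous (fun y => F y i j)}.
Proof.
split=> [cF i j|cF].
  apply: (@continuous_comp _ _ _ F (fun M : 'M[R]_(m, n) => M i j)) => //.
  exact: coord_continuous.
move=> A [P nP PA]; rewrite nbhs_simpl/=.
have H : \forall y \near x, forall ij : 'I_m * 'I_n,
    P ij.1 ij.2 (F y ij.1 ij.2).
  by apply: filter_forall => -[i j]; exact: (cF i j _ (nP i j)).
by apply: filterS H => y H; apply: PA => i j; exact: (H (i, j)).
Qed.

(** Pointwise and coordinatewise counterpart of [smooth_on], to which the scalar calculus applies.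
    The next two lemmas pass between the two notions, the second one on open sets. *)
Definition smooth_at d l (x : 'rV[R]_d) (F : 'rV[R]_d -> 'rV[R]_l) :=
  forall k j, Ck_at setT k x (fun y => F y ord0 j).

Lemma smooth_at_smooth_on d l (U : set 'rV[R]_d) (F : 'rV[R]_d -> 'rV[R]_l) :
  (forall x, U x -> smooth_at x F) -> smooth_on U F.
Proof.
move=> sF k; have {}sF : forall x, U x ->
    forall j, Ck_at setT k x (fun y => F y ord0 j) by move=> x Ux; exact: sF.
elim: k F sF => [|k IH] F sF /=.
  apply: continuous_in_subspaceT => x /set_mem Ux.
  by apply/matrix_continuousP => i j; rewrite ord1; exact: sF.
have dF x v : U x -> derivable F x v.
  move=> Ux; apply/derivable_mxP => i j; rewrite ord1.
  have [_ [f' f'P]] := sF x Ux j; have [dv _] := f'P v I.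
  by have [] := nbhs_singleton dv.
split=> // v; apply: IH => x Ux j.
have [_ [f' f'P]] := sF x Ux j; have [dv sv] := f'P v I.
(* [derive_mx] needs all coordinates to be differentiable at once; they are finitely many, so one
   neighbourhood serves them all. *)
have dall : \forall y \near x, forall j, derivable (fun y => F y ord0 j) y v.
  apply: (@filter_forall _ _
    (fun j' y => derivable (fun z => F z ord0 j') y v) (nbhs x)) => j'.
  have [_ [g' g'P]] := sF x Ux j'; have [gv _] := g'P v I.
  by apply: filterS gv => y [].
apply: Ck_at_near_eq sv; near=> y.
rewrite derive_mx; last first.
  by apply/derivable_mxP => i j'; rewrite ord1; move: j'; near: y.
rewrite mxE; have H : is_derive y v (fun y => F y ord0 j) (f' v y) by near: y.
by case: H.
Unshelve. all: by end_near. Qed.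

(** Openness of [U] turns continuity within [U] into continuity at [x] and provides derivatives at
    all nearby points. Each ['D_v F] is again smooth on [U], which feeds the induction. *)
Lemma smooth_on_smooth_at d l (U : set 'rV[R]_d) (F : 'rV[R]_d -> 'rV[R]_l) x :
  open U -> smooth_on U F -> U x -> smooth_at x F.
Proof.
move=> oU sF Ux k j.
have nU : \forall y \near x, U y by exact: open_nbhs_nbhs.
have cF (G : 'rV[R]_d -> 'rV[R]_l) : smooth_on U G ->
    {for x, continuous (fun y => G y ord0 j)}.
  move=> /(_ 0) /=; rewrite continuous_open_subspace// => cG.
  exact: (iffLR (matrix_continuousP G x) (cG x (mem_set Ux)) ord0 j).
elim: k F sF => [|k IH] F sF; first exact: cF.
split; first exact: cF.
exists (fun v y => ('D_v F y) ord0 j) => v _; split; last first.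
  by apply: IH => k'; have [_] := sF k'.+1; exact.
near=> y; have Uy : U y by near: y.
have [dF _] := sF 1.
have dFy := dF y v Uy.
rewrite derive_mx // mxE; apply: derivableP.
exact: (iffLR (derivable_mxP F y v) dFy).
Unshelve. all: by end_near. Qed.

End GermCalculus.

(** * The smooth step and its inverse *)

Section SmoothStep.
Context {R : realType}.
Local Notation bump := (@Defs.bump R).
Implicit Types (t x y : R) (k n : nat).

(** * The flat exponential and the bump function *)

Lemma is_derive_flat (f : R -> R) (C : R) :
  (forall t, `|f t| <= C * t ^+ 2) -> is_derive (0 : R) (1 : R) f 0.
Proof.
move=> fC; have f0 : f 0 = 0.
  by apply/eqP; rewrite -normr_le0 (le_trans (fC 0))// expr0n mulr0.
have C0 : 0 <= C by have := le_trans (normr_ge0 _) (fC 1); rewrite expr1n mulr1.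
suff H : (fun h : R => h^-1 *: (f (h *: (1 : R) + 0) - f 0)) h @[h --> 0^']
    --> (0 : R).
  by apply: DeriveDef; [exact: cvgP H|exact: cvg_lim H].
apply/cvgrPdist_le => e e0; near=> h.
have h0 : h != 0 by near: h; exact: nbhs_dnbhs_neq.
rewrite sub0r normrN f0 subr0 addr0 /GRing.scale/= mulr1 normrM normfV.
rewrite ler_pdivrMl ?normr_gt0//; apply: (le_trans (fC h)).
rewrite -real_normK ?num_real// expr2 mulrA [leRHS]mulrC.
apply: ler_wpM2r => //.
(* The difference quotient is at most [C * |h|]; the added 1 keeps the denominator positive when
   [C = 0]. *)
have he : `|h| <= e / (C + 1).
  by near: h; apply: dnbhs0_le; rewrite divr_gt0// ltr_wpDl.
apply: (le_trans (ler_wpM2l C0 he)).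
by rewrite mulrCA ger_pMr// ler_pdivrMr ?ltr_wpDl// mul1r lerDl.
Unshelve. all: by end_near. Qed.

(* The derivatives of [ell] are combinations of the functions [ellpow n]. *)
Definition ellpow n t := t^-1 ^+ n * ell t.

Lemma ellpow_le0 n t : t <= 0 -> ellpow n t = 0.
Proof. by move=> t0; rewrite /ellpow /ell t0 mulr0. Qed.

Lemma ellpow_gt0E n t : 0 < t -> ellpow n t = t^-1 ^+ n * expR (- t^-1).
Proof. by move=> t0; rewrite /ellpow /ell leNgt t0. Qed.

(** With [y = t^-1] this is the bound of [y ^+ n.+2 / n.+2!] by [expR y], a single term of the
    exponential series. The shift by two leaves the factor [t ^+ 2]. *)
Lemma ellpow_flat n t : `|ellpow n t| <= n.+2`!%:R * t ^+ 2.
Proof.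
have [t0|t0] := leP t 0.
  by rewrite ellpow_le0// normr0 mulr_ge0// sqr_ge0.
rewrite ellpow_gt0E//; have y0 : 0 < t^-1 by rewrite invr_gt0.
rewrite ger0_norm; last by rewrite mulr_ge0 ?expR_ge0// exprn_ge0// ltW.
rewrite expRN -ler_pdivlMl ?exprn_gt0//.
rewrite -[leRHS]invrK lef_pV2 ?posrE ?expR_gt0//; last first.
  by rewrite invr_gt0 !mulr_gt0 ?invr_gt0 ?exprn_gt0// ltr0n fact_gt0.
apply: le_trans (expR_ge1Dxn n.+1 (ltW y0)); rewrite -[leLHS]add0r lerD//.
by rewrite !invfM invrK -[in leRHS]addn2 exprD expr2 mulrCA [leRHS]mulrC addn2.
Qed.

(** The family is closed under differentiation, which gives all orders at once. The usual rules
    apply off 0, and at 0 the quadratic bound gives derivative 0. *)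
Lemma is_derive_ellpow n t :
  is_derive t 1 (ellpow n) (- n%:R * ellpow n.+1 t + ellpow n.+2 t).
Proof.
have [t0|t0|->] := ltgtP t 0.
- rewrite !ellpow_le0 ?(ltW t0)// mulr0 addr0.
  apply: near_eq_is_derive (is_derive_cst (0 : R) t (1 : R)).
  have H : \forall y \near t, y < 0 by exact: lt_nbhsl.
  by near=> y; rewrite ellpow_le0// ltW//; near: y.
- have tN0 : t != 0 by rewrite gt_eqF.
  apply: (@near_eq_is_derive _ _ _
    ((@GRing.inv R) ^+ n * (expR \o (fun y => - y^-1)))).
    have H : \forall y \near t, 0 < y by exact: lt_nbhsr.
    near=> y; rewrite ellpow_gt0E//; last by near: y.
    by congr (_ * _); elim: n => [|n IH] //; rewrite !exprS -IH.
  have dV := is_deriveV (f := id) tN0 (is_derive_id t 1).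
  have dE := @is_derive1_comp R expR (fun y => - y^-1) t _ _
    (is_derive_expR (- t^-1)) (is_deriveN dV).
  apply: (is_derive_eq (is_deriveM (is_deriveX n dV) dE)).
  rewrite !ellpow_gt0E//= /GRing.scale/= mulr1.
  have -> : ((@GRing.inv R) ^+ n) t = t^-1 ^+ n.
    by elim: n => [|n IH] //; rewrite !exprS -IH.
  rewrite -!exprVn.
  (* The power rule produces the exponent [n.-1], so [n = 0] is separate. *)
  case: n => [|n]; first by rewrite !expr0 /=; ring.
  by rewrite /= !exprS; ring.
- rewrite !ellpow_le0// mulr0 addr0.
  exact: is_derive_flat (ellpow_flat n).
Unshelve. all: by end_near. Qed.

Lemma Ck_at_ellpow k n t : Ck_at [set (1 : R)] k t (ellpow n).
Proof.
elim: k n => [|k IH] n; last first.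
  apply: Ck_at_deriveS (Ck_atD (Ck_atZ (- n%:R) (IH n.+1)) (IH n.+2)).
  by near=> y; exact: is_derive_ellpow.
have [d _] := is_derive_ellpow n t.
exact/differentiable_continuous/derivable1_diffP.
Unshelve. all: by end_near. Qed.

Lemma ell_ellpow : @ell R = ellpow 0.
Proof. by apply/funext => t; rewrite /ellpow expr0 mul1r. Qed.

Lemma ell_gt0 t : 0 < t -> 0 < ell t.
Proof. by move=> t0; rewrite /ell leNgt t0 expR_gt0. Qed.

Lemma Ck_at_bump k t : Ck_at [set (1 : R)] k t bump.
Proof.
rewrite /Defs.bump; apply: Ck_atM.
  apply: (@Ck_at_comp R _ _ k t (@ell R) (fun x : R => 3 * x)).
    by rewrite ell_ellpow; exact: Ck_at_ellpow.
  exact/Ck_atZ/Ck_at_id.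
apply: (@Ck_at_comp R _ _ k t (@ell R) (fun x : R => 3 - 3 * x)).
  by rewrite ell_ellpow; exact: Ck_at_ellpow.
by apply: Ck_atB; [exact: Ck_at_cst|exact/Ck_atZ/Ck_at_id].
Qed.

Lemma bump_le0 t : t <= 0 -> bump t = 0.
Proof. by move=> t0; rewrite /Defs.bump {1}/ell ifT ?mul0r// pmulr_rle0. Qed.

Lemma bump_gt0 t : 0 < t < 1 -> 0 < bump t.
Proof. by move=> /andP[t0 t1]; rewrite mulr_gt0// ell_gt0//; lra. Qed.

(** The reflection exchanges the two factors. The symmetries of [lam] and [phi] come from here. *)
Lemma bump_refl t : bump (1 - t) = bump t.
Proof. by rewrite /Defs.bump mulrC; congr (ell _ * ell _); ring. Qed.

(** An integral over a half-line has the shape required by the fundamental theorem of calculus and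
    treats both signs of [t] together. *)
Lemma oint_vanishing (f : R -> R) t : (forall x, x <= 0 -> f x = 0) ->
  oint 0 t f = Rintegral lebesgue_measure [set` `]-oo, t]] f.
Proof.
move=> f0; rewrite /oint [RHS]Rintegral_mkcond.
have [t0|t0] := leP 0 t.
  rewrite Rintegral_mkcond; congr Rintegral; apply/funext => x.
  rewrite !patchE; case: ifPn => [/set_mem/= /andP[x0 xt]|].
    by rewrite mem_set//= in_itv/=.
  move=> /negP H; case: ifPn => // /set_mem/=; rewrite in_itv/= => xt.
  rewrite f0//; have [//|x0] := leP x 0; exfalso; apply: H; rewrite inE/=.
  by rewrite xt (ltW x0).
have Z (D : set R) : D `<=` [set x | x <= 0] ->
    Rintegral (@lebesgue_measure R) D f = 0.
  move=> D0; rewrite (@eq_Rintegral _ _ _ _ _ (fun=> 0)) => [|x /set_mem /D0].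
    by rewrite /Rintegral integral0.
  exact: f0.
rewrite -Rintegral_mkcond !Z ?oppr0// => x /=.
  by rewrite in_itv/= => /le_trans; apply; exact: ltW.
by move=> /andP[].
Qed.

Lemma is_derive_oint (f : R -> R) t : continuous f ->
  (forall x, x <= 0 -> f x = 0) ->
  is_derive t 1 (fun x => oint 0 x f) (f t).
Proof.
(* [u] is any bound above both [t] and 0: [f] is integrable on [[0, u]] by compactness and vanishes
   to the left of it. *)
move=> cf f0; pose u := Num.max 0 t + 1.
have tu : t < u by rewrite /u ltr_pwDr// le_max lexx orbT.
have u0 : 0 < u by rewrite /u ltr_wpDl// le_max lexx.
have intf : lebesgue_measure.-integrable `]-oo, u] (EFin \o f).
  have : lebesgue_measure.-integrable `[0, u] (EFin \o f).
    by apply: continuous_compact_integrable;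
      [exact: segment_compact|exact: continuous_subspaceT].
  rewrite integrable_mkcond// => int0; rewrite integrable_mkcond//.
  move: int0; congr (_.-integrable _ _).
  apply/funext => x; rewrite !patchE !mem_setE !in_itv/=.
  have [//|x0] := leP 0 x; rewrite /= f0 ?(ltW x0)//.
  by case: ifP.
have [dF eF] := continuous_FTC1 tu intf (ltNyr _) (cf t).
rewrite (_ : (fun x => _) =
    fun x => Rintegral lebesgue_measure [set` `]-oo, x]] f); last first.
  by apply/funext => x; exact: oint_vanishing.
by apply: DeriveDef => //; rewrite -eF derive1E.
Qed.

Lemma bump_continuous : continuous bump.
Proof. by move=> t; exact: (Ck_at_bump 0 t). Qed.

Lemma oint_le0 (f : R -> R) t : (forall x, x <= 0 -> f x = 0) -> t <= 0 ->
  oint 0 t f = 0.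
Proof.
move=> f0 t0; rewrite oint_vanishing// (@eq_Rintegral _ _ _ _ _ (fun=> 0)).
  by rewrite /Rintegral integral0.
by move=> x /set_mem/=; rewrite in_itv/= => xt; rewrite f0// (le_trans xt).
Qed.

Lemma MVT_derive (f f' : R -> R) a b : a < b ->
  (forall x, is_derive x 1 f (f' x)) ->
  exists2 c, a < c < b & f b - f a = f' c * (b - a).
Proof.
move=> ab df; have [|c] := MVT ab (fun x _ => df x).
  apply: continuous_subspaceT => x; have [d _] := df x.
  exact/differentiable_continuous/derivable1_diffP.
by rewrite in_itv/= => cab E; exists c.
Qed.

Lemma is_derive_oint_bump t : is_derive t 1 (fun x => oint 0 x bump) (bump t).
Proof. apply: is_derive_oint; [exact: bump_continuous|exact: bump_le0]. Qed.

(** By the mean value theorem the integral equals a value of [bump] inside the unit interval. *)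
Lemma alpha0_gt0 : 0 < alpha0 R.
Proof.
have [c c01] := MVT_derive ltr01 is_derive_oint_bump.
rewrite (oint_le0 bump_le0 (lexx 0)) !subr0 mulr1 /alpha0 => ->.
exact: bump_gt0.
Qed.

(** * The step [lam] and its primitive [phi] *)

Local Notation lam := (@lam R).
Local Notation phi := (@phi R).

Lemma is_derive_lam t : is_derive t 1 lam ((alpha0 R)^-1 * bump t).
Proof. exact: (is_deriveZ _ (is_derive_oint_bump t)). Qed.

Lemma Ck_at_lam k t : Ck_at [set (1 : R)] k t lam.
Proof.
apply/Ck_atW/Ck_at_deriveS; last exact: (Ck_atZ (alpha0 R)^-1 (Ck_at_bump k t)).
by near=> y; exact: is_derive_lam.
Unshelve. all: by end_near. Qed.

Lemma lam_le0 t : t <= 0 -> lam t = 0.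
Proof. by move=> t0; rewrite /Defs.lam (oint_le0 bump_le0 t0) mulr0. Qed.

Lemma lam1 : lam 1 = 1.
Proof. by rewrite /Defs.lam -/(alpha0 R) mulVf// gt_eqF// alpha0_gt0. Qed.

Lemma is_derive_reflect (f : R -> R) (c t df : R) :
  is_derive (c - t) (1 : R) f df ->
  is_derive t (1 : R) (fun x => f (c - x)) (- df).
Proof.
move=> dfc; have d : is_derive t (1 : R) (fun x : R => c - x) (-1).
  by apply: (is_derive_eq (is_deriveB (is_derive_cst c t (1 : R))
    (is_derive_id t (1 : R)))); rewrite sub0r.
by apply: (is_derive_eq (@is_derive1_comp R f _ t _ _ dfc d)); rewrite mulrN1.
Qed.

(** The left-hand side has derivative 0 by [bump_refl], and its value at [t = 1] is known. *)
Lemma lam_refl t : lam t + lam (1 - t) = 1.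
Proof.
transitivity (lam 1 + lam (1 - 1)); last by rewrite lam1 subrr lam_le0// addr0.
apply: (@is_derive_0_is_cst R (fun x => lam x + lam (1 - x)) t 1) => x.
apply: (is_derive_eq (is_deriveD (is_derive_lam x)
  (is_derive_reflect (is_derive_lam (1 - x))))).
by rewrite bump_refl subrr.
Qed.

Lemma lam_gt0 t : 0 < t -> 0 < lam t.
Proof.
move=> t0; have [t1|t1] := leP 1 t.
  have := lam_refl t; rewrite (@lam_le0 (1 - t)) ?subr_le0// addr0 => ->.
  exact: ltr01.
have [c /andP[c0 ct]] := MVT_derive t0 is_derive_lam.
rewrite (lam_le0 (lexx 0)) !subr0 => ->.
apply: mulr_gt0 => //; apply: mulr_gt0; first by rewrite invr_gt0 alpha0_gt0.
by apply: bump_gt0; rewrite c0 (lt_trans ct).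
Qed.

Lemma lam_continuous : continuous lam.
Proof. by move=> t; exact: (Ck_at_lam 0 t). Qed.

Lemma is_derive_phi t : is_derive t 1 phi (lam (2^-1 + t)).
Proof.
have d : is_derive t (1 : R) (fun x : R => 2^-1 + x) 1.
  by apply: (is_derive_eq (is_deriveD (is_derive_cst (2^-1 : R) t (1 : R))
    (is_derive_id t (1 : R)))); rewrite add0r.
have di := is_derive_oint (2^-1 + t) lam_continuous lam_le0.
apply: (is_derive_eq (@is_derive1_comp R (fun x => oint 0 x lam) _ t _ _ di d)).
by rewrite mulr1.
Qed.

Lemma Ck_at_phi k t : Ck_at [set (1 : R)] k t phi.
Proof.
apply/Ck_atW/(@Ck_at_deriveS _ _ _ _ (fun x => lam (2^-1 + x))).
  by near=> y; exact: is_derive_phi.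
apply: (@Ck_at_comp R _ _ k t lam (fun x => 2^-1 + x)); first exact: Ck_at_lam.
by apply: Ck_atD; [exact: Ck_at_cst|exact: Ck_at_id].
Unshelve. all: by end_near. Qed.

Lemma phi_continuous : continuous phi.
Proof. by move=> t; exact: (Ck_at_phi 0 t). Qed.

Lemma phi_le t : t <= - 2^-1 -> phi t = 0.
Proof. by move=> t0; apply: (oint_le0 lam_le0); lra. Qed.

(** Integrated form of [lam_refl]: the function [phi x - phi (- x) - x] has derivative 0 and
    vanishes at 0. *)
Lemma phi_refl t : phi t = t + phi (- t).
Proof.
have H : phi t - phi (0 - t) - t = phi 0 - phi (0 - 0) - 0.
  apply: (@is_derive_0_is_cst R (fun x => phi x - phi (0 - x) - x) t 0) => x.
  apply: (is_derive_eq (is_deriveB (is_deriveB (is_derive_phi x)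
    (is_derive_reflect (is_derive_phi (0 - x)))) (is_derive_id x (1 : R)))).
  rewrite opprK -[X in _ - X](lam_refl (2^-1 + x)).
  by rewrite (_ : 1 - (2^-1 + x) = 2^-1 + (0 - x)) ?subrr//; field.
by move: H; rewrite sub0r !subr0 subrr; lra.
Qed.

Lemma phi_lt a b : - 2^-1 <= a -> a < b -> phi a < phi b.
Proof.
move=> a2 ab; have [c /andP[ac cb] E] := MVT_derive ab is_derive_phi.
rewrite -subr_gt0 E mulr_gt0 ?subr_gt0// lam_gt0//; lra.
Qed.

Lemma phi_gt0 t : - 2^-1 < t -> 0 < phi t.
Proof. by move=> t2; rewrite -(phi_le (lexx (- 2^-1))) phi_lt. Qed.

Lemma phi_ge0 t : 0 <= phi t.
Proof. by have [/phi_le ->//|/phi_gt0/ltW//] := leP t (- 2^-1). Qed.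

Lemma phi_homo a b : a <= b -> phi a <= phi b.
Proof.
move=> ab; have [a2|a2] := leP a (- 2^-1); first by rewrite phi_le// phi_ge0.
move: ab; rewrite le_eqVlt => /predU1P[->//|ab]; exact/ltW/phi_lt/ab/ltW.
Qed.

Lemma phi_ltr a b : phi a < phi b -> a < b.
Proof.
move=> ab; rewrite ltNge; apply: contraPN (ab) => /phi_homo.
by rewrite leNgt => /negP.
Qed.

Lemma phi_id t : 2^-1 <= t -> phi t = t.
Proof. by move=> t2; rewrite phi_refl phi_le ?addr0// lerN2. Qed.

Lemma phi_onto y : 0 < y -> exists t, - 2^-1 < t /\ phi t = y.
Proof.
move=> y0; have b0 : - 2^-1 <= y + 2^-1 by lra.
(* The upper end [y + 2^-1] lies beyond [2^-1], where [phi] is the identity, so the value there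
   exceeds [y]. *)
have [||t] := @IVT R phi (- 2^-1) (y + 2^-1) y b0.
- exact/continuous_subspaceT/phi_continuous.
- have E1 : phi (- 2^-1) = 0 by rewrite phi_le.
  have E2 : phi (y + 2^-1) = y + 2^-1 by rewrite phi_id//; lra.
  by rewrite E1 E2 min_l ?max_r; lra.
rewrite in_itv/= => /andP[t1 _] E; exists t; split=> //.
rewrite lt_neqAle t1 andbT; apply/eqP => t2.
by move: y0; rewrite -E -t2 phi_le// ltxx.
Qed.

(** The inverse function of [phi] on positive reals. The default [- 2^-1] extends it continuously to
    nonpositive reals and makes the branches glued below constant there. *)
Definition psi y : R := xget (- 2^-1) [set t | - 2^-1 < t /\ phi t = y].

Lemma psi_le0 y : y <= 0 -> psi y = - 2^-1.
Proof.
move=> y0; apply: xgetPN => t [/phi_gt0 + ty].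
by rewrite ty ltNge y0.
Qed.

Lemma psiP y : 0 < y -> - 2^-1 < psi y /\ phi (psi y) = y.
Proof.
move=> /phi_onto[t ty].
exact: (@xgetPex _ (- 2^-1) [set t | - 2^-1 < t /\ phi t = y] (ex_intro _ t ty)).
Qed.

Lemma psi_ge y : - 2^-1 <= psi y.
Proof.
by have [/psi_le0 ->//|/psiP[/ltW]] := leP y 0.
Qed.

Lemma psiK y : 0 <= y -> phi (psi y) = y.
Proof.
rewrite le_eqVlt => /predU1P[<-|/psiP[]//].
by rewrite psi_le0// phi_le.
Qed.

Lemma phi_inj a b : - 2^-1 <= a -> - 2^-1 <= b -> phi a = phi b -> a = b.
Proof.
move=> a2 b2 E; have [ab|ba|//] := ltgtP a b.
  by have := phi_lt a2 ab; rewrite E ltxx.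
by have := phi_lt b2 ba; rewrite E ltxx.
Qed.

Lemma phiK t : - 2^-1 <= t -> psi (phi t) = t.
Proof.
move=> t2; apply: phi_inj => //; first exact: psi_ge.
by rewrite psiK// phi_ge0.
Qed.

Lemma psi_continuous : continuous psi.
Proof.
move=> y; apply/cvgrPdist_lt => e e0.
have H1 : \forall z \near y, z < phi (psi y + e).
  apply: lt_nbhsl; have [y0|y0] := leP y 0; last first.
    by rewrite -{1}(psiP y0).2 phi_lt ?psi_ge// ltrDl.
  by rewrite (le_lt_trans y0)// phi_gt0// psi_le0// ltrDl.
have H2 : \forall z \near y, psi y - e < psi z.
  (* If the bound is below [- 2^-1], it holds for every [z]; otherwise [y > 0] and [phi] can be
     applied to it. *)
  have [y2|y2] := ltP (psi y - e) (- 2^-1).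
    by near=> z; exact: lt_le_trans (psi_ge z).
  have y0 : 0 < y.
    by rewrite ltNge; apply/negP => /psi_le0 E; move: y2; rewrite E; lra.
  have Hz : \forall z \near y, phi (psi y - e) < z.
    by apply: lt_nbhsr; rewrite -{2}(psiP y0).2 phi_lt// gtrBl.
  near=> z; apply: phi_ltr; have zz : phi (psi y - e) < z by near: z.
  by rewrite psiK// (le_trans (phi_ge0 _) (ltW zz)).
near=> z; rewrite distrC ltr_distl; apply/andP; split; first by near: z.
apply: phi_ltr; have [z0|z0] := leP z 0; last by rewrite (psiP z0).2; near: z.
by rewrite psi_le0// phi_le// phi_gt0// (le_lt_trans (psi_ge y))// ltrDl.
Unshelve. all: by end_near. Qed.

(** The slope of [phi] at [psi y] is nonzero because [psi y > - 2^-1]. *)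
Lemma is_derive_psi y : 0 < y -> is_derive y 1 psi (lam (2^-1 + psi y))^-1.
Proof.
move=> y0; have [p2 E] := psiP y0; rewrite -{1}E.
apply: is_derive_inverse.
- have H : \forall t \near psi y, - 2^-1 < t by exact: lt_nbhsr.
  by near=> t; rewrite phiK// ltW//; near: t.
- by near=> t; exact: phi_continuous.
- exact: is_derive_phi.
- by rewrite gt_eqF// lam_gt0//; lra.
Unshelve. all: by end_near. Qed.

(** The derivative is a smooth expression in [psi] itself, so each order of regularity yields the
    next. *)
Lemma Ck_at_psi k y : 0 < y -> Ck_at [set (1 : R)] k y psi.
Proof.
move=> y0; elim: k => [|k IH]; first exact: psi_continuous.
apply: (@Ck_at_deriveS _ _ _ _ (fun x => (lam (2^-1 + psi x))^-1)).
  have H : \forall x \near y, 0 < x by exact: lt_nbhsr.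
  by near=> x; apply: is_derive_psi; near: x.
apply: (@Ck_at_comp R _ _ k y GRing.inv (fun x => lam (2^-1 + psi x))).
  by apply: Ck_at_inv; rewrite gt_eqF// lam_gt0//; have [] := psiP y0; lra.
apply: (@Ck_at_comp R _ _ k y lam (fun x => 2^-1 + psi x)); first exact: Ck_at_lam.
by apply: Ck_atD => //; exact: Ck_at_cst.
Unshelve. all: by end_near. Qed.

End SmoothStep.

(** * The map in polar radii *)

Section PlanarMap.
Context {R : realType}.
Implicit Types a r s p q t : R.
Local Notation phi := (@phi R).

(** [dip] and [swell] are the parameters [t] and [a]. The affine arguments send [r = 1] to [- 2^-1],
    where [phi] becomes flat, and give [dip 0 = 1]. *)
Definition dip r := phi (3 / 2 - 2 * r) - 2^-1.
Definition swell r := phi (r - 3 / 2).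
(** Here and in [stretch] the branches for [r <= 1] and [r >= 1] are added and their common value at
    [r = 1] is subtracted: 1 for [radial], 3/2 for [stretch]. On each side one branch equals that
    constant. *)
Definition radial r s := 1 - phi (dip r) + swell r * (1 - s ^+ 2).
Definition stretch r := phi (- dip r) - 2^-1 + Num.sqrt (9 / 4 + swell r).

Definition inv_dip p := psi (1 - p).
(* The nonnegative root [a] of [(9/4 + a) (p - 1) = a (9/4 + a - q^2)]. *)
Definition inv_swell p q :=
  (- (9 / 4 - q ^+ 2 - (p - 1)) +
   Num.sqrt ((9 / 4 - q ^+ 2 - (p - 1)) ^+ 2 + 9 * (p - 1))) / 2.
(** Sum of the inner solution [(3 / 2 - psi (inv_dip p + 2^-1)) / 2] and the outer solution
    [psi (inv_swell p q) + 3 / 2], minus their common value 1. *)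
Definition inv_radial p q :=
  (3 / 2 - psi (inv_dip p + 2^-1)) / 2 + psi (inv_swell p q) + 2^-1.
(** [phi (psi a)] is the positive part of [a]; it discards the root on the inner side, where it is
    nonpositive. *)
Definition inv_stretch p q :=
  phi (- inv_dip p) - 2^-1 + Num.sqrt (9 / 4 + phi (psi (inv_swell p q))).

Definition in_domain p q := 1 - phi (2 - p - q) <= p.

Lemma sqrt_9_4 : Num.sqrt (9 / 4) = 3 / 2 :> R.
Proof.
rewrite (_ : 9 / 4 = (3 / 2) ^+ 2); last by field.
by rewrite sqrtr_sqr ger0_norm// divr_ge0.
Qed.

Lemma dip_ge r : - 2^-1 <= dip r.
Proof. by rewrite /dip; have := phi_ge0 (3 / 2 - 2 * r); lra. Qed.

Lemma dip_gt r : r < 1 -> - 2^-1 < dip r.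
Proof. by move=> r1; rewrite /dip ltrBrDl subrr phi_gt0//; lra. Qed.

Lemma dip_ge1 r : 1 <= r -> dip r = - 2^-1.
Proof. by move=> r1; rewrite /dip phi_le ?sub0r//; lra. Qed.

Lemma dip_near0 r : r <= 2^-1 -> dip r = 1 - 2 * r.
Proof. by move=> r1; rewrite /dip phi_id; lra. Qed.

Lemma psi_dip r : r <= 1 -> psi (dip r + 2^-1) = 3 / 2 - 2 * r.
Proof. by move=> r1; rewrite /dip subrK phiK//; lra. Qed.

Lemma swell_le1 r : r <= 1 -> swell r = 0.
Proof. by move=> r1; rewrite /swell phi_le//; lra. Qed.

Lemma swell_ge0 r : 0 <= swell r.
Proof. exact: phi_ge0. Qed.

Lemma radial_le1 r s : r <= 1 -> radial r s = 1 - phi (dip r).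
Proof. by move=> r1; rewrite /radial swell_le1// mul0r addr0. Qed.

Lemma radial_ge1 r s : 1 <= r -> radial r s = 1 + swell r * (1 - s ^+ 2).
Proof. by move=> r1; rewrite /radial dip_ge1// phi_le// subr0. Qed.

(** With [stretch_near0], this makes the map linear near [u = 0], namely [(2 u, v)], so that the
    norm, not smooth at 0, does no harm. *)
Lemma radial_near0 r s : r <= 4^-1 -> radial r s = 2 * r.
Proof.
by move=> r1; rewrite radial_le1 ?dip_near0 ?phi_id; lra.
Qed.

Lemma stretch_le1 r : r <= 1 -> stretch r = 1 + phi (- dip r).
Proof. by move=> r1; rewrite /stretch swell_le1// addr0 sqrt_9_4; lra. Qed.

Lemma stretch_ge1 r : 1 <= r -> stretch r = Num.sqrt (9 / 4 + swell r).
Proof.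
by move=> r1; rewrite /stretch dip_ge1// opprK phi_id// subrr add0r.
Qed.

Lemma stretch_near0 r : r <= 4^-1 -> stretch r = 1.
Proof.
by move=> r1; rewrite stretch_le1 ?dip_near0 ?phi_le ?addr0; lra.
Qed.

Lemma stretch_gt0 r : 0 < stretch r.
Proof.
have [r1|/ltW r1] := leP r 1.
  by rewrite stretch_le1// ltr_pwDl// phi_ge0.
by rewrite stretch_ge1// sqrtr_gt0 ltr_pwDl ?swell_ge0// divr_gt0.
Qed.

Lemma stretch_lt r : r < 1 -> stretch r < 3 / 2.
Proof.
move=> r1; rewrite stretch_le1 1?ltW//.
have : phi (- dip r) < phi 2^-1.
  have [t2|t2] := leP (- dip r) (- 2^-1).
    by rewrite phi_le// phi_id// invr_gt0.
  by apply: phi_lt; [exact: ltW|have := dip_gt r1; lra].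
by rewrite (@phi_id _ 2^-1)//; lra.
Qed.

Lemma radial_lt1 r s : r < 1 -> radial r s < 1.
Proof.
move=> r1; rewrite radial_le1 1?ltW//.
by have := phi_gt0 (dip_gt r1); lra.
Qed.

Lemma radial_gt0 r s : 0 < r < 1 -> 0 < radial r s.
Proof.
move=> /andP[r0 r1]; rewrite radial_le1 ?(ltW r1)// subr_gt0.
rewrite -(@phi_id _ 1); last by lra.
apply: phi_lt; first exact: dip_ge.
suff : phi (3 / 2 - 2 * r) < phi (3 / 2) by rewrite (@phi_id _ (3/2)) /dip; lra.
by apply: phi_lt; lra.
Qed.

Lemma ge1_radial r s : 1 <= r -> 0 <= s <= 1 -> 1 <= radial r s.
Proof.
move=> r1 /andP[s0 s1]; rewrite radial_ge1// lerDl mulr_ge0 ?swell_ge0//.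
by rewrite subr_ge0 expr_le1.
Qed.

Lemma radial_ge0 r s : 0 <= r -> 0 <= s <= 1 -> 0 <= radial r s.
Proof.
rewrite le_eqVlt => /predU1P[<-|r0] s01; first by rewrite radial_near0 ?mulr0.
have [r1|r1] := ltP r 1; first by rewrite ltW// radial_gt0// r0.
by rewrite (le_trans ler01)// ge1_radial.
Qed.

Lemma radial_neq0 r s : 0 < r -> 0 <= s <= 1 -> radial r s != 0.
Proof.
move=> r0 s01; have [r1|r1] := ltP r 1.
  by rewrite gt_eqF// radial_gt0// r0.
by rewrite gt_eqF// (lt_le_trans ltr01)// ge1_radial.
Qed.

(** The square root dominates [|b|], since [9 * (p - 1)] is nonnegative. *)
Lemma inv_swell_ge0 p q : 1 <= p -> 0 <= inv_swell p q.
Proof.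
move=> p1; rewrite /inv_swell; set b := 9 / 4 - _ - _.
rewrite divr_ge0// addrC subr_ge0.
apply: (le_trans (ler_norm b)); rewrite -sqrtr_sqr ler_wsqrtr// lerDl.
by rewrite mulr_ge0// subr_ge0.
Qed.

Lemma inv_swell_eq p q : 1 <= p ->
  (9 / 4 + inv_swell p q) * (p - 1) =
  inv_swell p q * (9 / 4 + inv_swell p q - q ^+ 2).
Proof.
move=> p1; rewrite /inv_swell; set b := 9 / 4 - _ - _.
have : Num.sqrt (b ^+ 2 + 9 * (p - 1)) ^+ 2 = b ^+ 2 + 9 * (p - 1).
  by rewrite sqr_sqrtr// addr_ge0 ?sqr_ge0// mulr_ge0// subr_ge0.
set d := Num.sqrt _; move=> dE.
(* Eliminating [p] and [q ^+ 2] in favour of [b] and the root [d] leaves a polynomial identity. *)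
have pE : p = (d ^+ 2 - b ^+ 2) / 9 + 1 by rewrite dE; field.
have qE : q ^+ 2 = 9 / 4 - b - (p - 1) by rewrite /b; ring.
by rewrite qE pE; field.
Qed.

(** Now [b >= 0] and the radicand is at most [b ^+ 2]. A negative radicand is covered too, its
    [Num.sqrt] being 0. *)
Lemma inv_swell_le0 p q : p <= 1 -> 0 <= q <= 3 / 2 -> inv_swell p q <= 0.
Proof.
move=> p1 /andP[q0 q1]; rewrite /inv_swell; set b := 9 / 4 - _ - _.
have b0 : 0 <= b by rewrite /b; nra.
rewrite pmulr_lle0 ?invr_gt0// addrC subr_le0.
rewrite -[leRHS](ger0_norm b0) -sqrtr_sqr ler_wsqrtr// gerDl.
by rewrite mulr_ge0_le0// subr_le0.
Qed.

(** A zero root would force [p = 1] in the quadratic equation; then [b = 9 / 4 - q ^+ 2] is negative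
    and the root is [- b]. The hypothesis describes the points with [p >= 1] outside [d0SSnm]. *)
Lemma inv_swell_gt0 p q : 1 < p \/ p = 1 /\ 3 / 2 < q -> 0 < inv_swell p q.
Proof.
move=> pq; have p1 : 1 <= p by case: pq => [/ltW|[->]].
rewrite lt_neqAle inv_swell_ge0// andbT; apply/eqP => E.
have := inv_swell_eq q p1; rewrite -E mul0r => /eqP.
case: pq => [p1'|[pE q1]]; first by rewrite mulf_eq0 subr_eq0 (gt_eqF p1'); lra.
move: E; rewrite /inv_swell pE subrr mulr0 addr0 subr0 sqrtr_sqr ltr0_norm; nra.
Qed.

(** This is what puts [s = q / H] in the unit interval. For a positive root it is read off from the
    signs in [inv_swell_eq]. *)
Lemma sqr_le_inv_swell p q : 1 <= p -> 0 <= q -> q ^+ 2 <= 9 / 4 + inv_swell p q.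
Proof.
move=> p1 q0; have := inv_swell_ge0 q p1; rewrite le_eqVlt => /predU1P[E|a0].
  rewrite -E addr0; have := inv_swell_eq q p1; rewrite -E mul0r => /eqP.
  rewrite addr0 mulf_eq0 subr_eq0 => pE.
  have {}pE : p = 1 by case/orP: pE => /eqP; lra.
  have [//|q1] := leP (q ^+ 2) (9 / 4).
  suff : 0 < inv_swell p q by rewrite -E ltxx.
  by apply: inv_swell_gt0; right; split=> //; nra.
by have := inv_swell_eq q p1; nra.
Qed.

(** With [c = 9 / 4 * (1 - s ^+ 2)] the discriminant is [(c - a) ^+ 2 + 4 * a * c], the perfect
    square of [c + a]. *)
Lemma inv_swellK a s : 0 <= a -> 0 <= s <= 1 ->
  inv_swell (1 + a * (1 - s ^+ 2)) (s * Num.sqrt (9 / 4 + a)) = a.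
Proof.
move=> a0 /andP[s0 s1]; rewrite /inv_swell exprMn sqr_sqrtr; last by lra.
have -> : 9 / 4 - s ^+ 2 * (9 / 4 + a) - (1 + a * (1 - s ^+ 2) - 1) =
  9 / 4 * (1 - s ^+ 2) - a by ring.
have -> : (9 / 4 * (1 - s ^+ 2) - a) ^+ 2 + 9 * (1 + a * (1 - s ^+ 2) - 1) =
  (9 / 4 * (1 - s ^+ 2) + a) ^+ 2 by field.
rewrite sqrtr_sqr ger0_norm; first by field.
by rewrite addr_ge0// mulr_ge0 ?divr_ge0// subr_ge0 expr_le1.
Qed.

Lemma inv_dip_ge1 p : 1 <= p -> inv_dip p = - 2^-1.
Proof. by move=> p1; rewrite /inv_dip psi_le0// subr_le0. Qed.

Lemma inv_radial_ge1 p q : 1 <= p ->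
  inv_radial p q = psi (inv_swell p q) + 3 / 2.
Proof.
move=> p1; rewrite /inv_radial inv_dip_ge1//.
by rewrite [- 2^-1 + 2^-1]addrC subrr (@psi_le0 _ 0)//; lra.
Qed.

Lemma inv_stretch_ge1 p q : 1 <= p ->
  inv_stretch p q = Num.sqrt (9 / 4 + inv_swell p q).
Proof.
move=> p1; rewrite /inv_stretch inv_dip_ge1// opprK phi_id// subrr add0r.
by rewrite psiK// inv_swell_ge0.
Qed.

Lemma inv_radial_le1 p q : p <= 1 -> 0 <= q <= 3 / 2 ->
  inv_radial p q = (3 / 2 - psi (inv_dip p + 2^-1)) / 2.
Proof.
move=> p1 q1; rewrite /inv_radial (@psi_le0 _ (inv_swell p q)) ?subrK//.
exact: inv_swell_le0.
Qed.

Lemma inv_stretch_le1 p q : p <= 1 -> 0 <= q <= 3 / 2 ->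
  inv_stretch p q = 1 + phi (- inv_dip p).
Proof.
move=> p1 q1; rewrite /inv_stretch psi_le0 ?inv_swell_le0// (@phi_le _ (- 2^-1))//.
by rewrite addr0 sqrt_9_4; lra.
Qed.

Lemma inv_stretch_gt0 p q : 0 < inv_stretch p q.
Proof.
rewrite /inv_stretch.
have : 3 / 2 <= Num.sqrt (9 / 4 + phi (psi (inv_swell p q))).
  by rewrite -sqrt_9_4 ler_wsqrtr// lerDl phi_ge0.
by have := phi_ge0 (- inv_dip p); lra.
Qed.

Lemma inv_radial_near0 p q : 0 <= p <= 2^-1 -> 0 <= q <= 3 / 2 ->
  inv_radial p q = p / 2.
Proof.
move=> /andP[p0 p1] q1; rewrite inv_radial_le1//; last by lra.
have -> : inv_dip p = 1 - p by rewrite /inv_dip -{1}(@phi_id _ (1 - p)) ?phiK; lra.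
by rewrite -[X in psi X](@phi_id _ (1 - p + 2^-1)) ?phiK; lra.
Qed.

Lemma inv_stretch_near0 p q : 0 <= p <= 2^-1 -> 0 <= q <= 3 / 2 ->
  inv_stretch p q = 1.
Proof.
move=> /andP[p0 p1] q1; rewrite inv_stretch_le1//; last by lra.
have -> : inv_dip p = 1 - p by rewrite /inv_dip -{1}(@phi_id _ (1 - p)) ?phiK; lra.
by rewrite phi_le ?addr0; lra.
Qed.

Lemma in_domain_radial r s : 0 <= r -> 0 <= s <= 1 ->
  in_domain (radial r s) (s * stretch r).
Proof.
move=> r0 /[dup] s01 /andP[s0 s1]; rewrite /in_domain.
have [r1|r1] := ltP r 1; last first.
  have := ge1_radial r1 s01.
  by have := phi_ge0 (2 - radial r s - s * stretch r); lra.
rewrite radial_le1 ?(ltW r1)// stretch_le1 ?(ltW r1)// lerB//.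
(* By [phi_refl], [2 - X - H = dip r]; replacing [H] by [s * H] with [s <= 1] only increases the
   left-hand side. *)
apply: phi_homo; have := phi_refl (dip r); have := phi_ge0 (- dip r); nra.
Qed.

(** Membership says [phi t <= phi (2 - p - q)] for [t = inv_dip p]. Strict monotonicity removes
    [phi], and [phi_refl] rewrites the bound; it amounts to [s <= 1]. *)
Lemma in_domain_lt1 p q : in_domain p q -> p < 1 -> q <= 1 + phi (- inv_dip p).
Proof.
rewrite /in_domain => D p1; have [t2 tE] := @psiP _ (1 - p) ltac:(lra).
have := phi_refl (inv_dip p); rewrite -/(inv_dip p) in t2 tE.
have : inv_dip p <= 2 - p - q.
  rewrite leNgt; apply/negP => lt2.
  have : phi (2 - p - q) < phi (inv_dip p).
    have [h2|h2] := leP (2 - p - q) (- 2^-1); last exact: phi_lt (ltW h2) lt2.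
    by rewrite (phi_le h2) tE; lra.
  by rewrite tE; lra.
lra.
Qed.

Lemma inv_dip_gt p : p < 1 -> - 2^-1 < inv_dip p.
Proof. by move=> p1; have [] := @psiP _ (1 - p) ltac:(lra). Qed.

Lemma in_domain_lt32 p q : in_domain p q -> p < 1 -> q < 3 / 2.
Proof.
move=> D p1; apply: le_lt_trans (in_domain_lt1 D p1) _.
suff : phi (- inv_dip p) < 2^-1 by lra.
have t2 := inv_dip_gt p1.
rewrite -[ltRHS](@phi_id _ 2^-1)//.
have [h2|h2] := leP (- inv_dip p) (- 2^-1); last by apply: phi_lt; lra.
by rewrite phi_le// phi_id// invr_gt0.
Qed.

Lemma radialK r s : 0 <= r -> 0 <= s <= 1 ->
  inv_radial (radial r s) (s * stretch r) = r /\
  inv_stretch (radial r s) (s * stretch r) = stretch r.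
Proof.
move=> r0 /[dup] s01 /andP[s0 s1]; have [r1|r1] := ltP r 1.
  have p1 := radial_lt1 s r1; have q1 := stretch_lt r1; have h0 := stretch_gt0 r.
  have q01 : 0 <= s * stretch r <= 3 / 2 by apply/andP; split; nra.
  rewrite inv_radial_le1 ?inv_stretch_le1 ?(ltW p1)//.
  have -> : inv_dip (radial r s) = dip r.
    rewrite /inv_dip radial_le1 ?(ltW r1)// opprB addrC subrK phiK//.
    exact: dip_ge.
  rewrite psi_dip ?(ltW r1)// stretch_le1 ?(ltW r1)//.
  by split=> //; field.
have p1 := ge1_radial r1 s01; rewrite inv_radial_ge1// inv_stretch_ge1//.
rewrite radial_ge1// stretch_ge1// inv_swellK ?swell_ge0//.
by split=> //; rewrite /swell phiK ?subrK//; lra.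
Qed.

Lemma inv_radialK p q : 0 <= p -> 0 <= q -> in_domain p q ->
  [/\ 0 <= inv_radial p q, q <= inv_stretch p q,
      radial (inv_radial p q) (q / inv_stretch p q) = p &
      stretch (inv_radial p q) = inv_stretch p q].
Proof.
move=> p0 q0 D; have k0 := inv_stretch_gt0 p q; have [p1|p1] := ltP p 1.
  have q1 := in_domain_lt32 D p1.
  have q01 : 0 <= q <= 3 / 2 by rewrite q0 ltW.
  have t2 := inv_dip_gt p1; have [_ tE] := @psiP _ (1 - p) ltac:(lra).
  rewrite -/(inv_dip p) in tE; have qt := in_domain_lt1 D p1.
  (* The bound comes from [phi t = 1 - p <= 1 = phi 1]. It leads to [w1], which makes the recovered
     radius nonnegative. *)
  have t1 : inv_dip p <= 1.
    rewrite leNgt; apply/negP => t1.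
    have : phi 1 < phi (inv_dip p) by apply: phi_lt => //; lra.
    by rewrite (@phi_id _ 1) ?tE; lra.
  have u0 : 0 < inv_dip p + 2^-1 by lra.
  have [w2 wE] := psiP u0.
  have w1 : psi (inv_dip p + 2^-1) <= 3 / 2.
    rewrite leNgt; apply/negP => w1.
    have : phi (3 / 2) < phi (psi (inv_dip p + 2^-1)) by apply: phi_lt => //; lra.
    by rewrite (@phi_id _ (3 / 2)) ?wE; lra.
  rewrite inv_stretch_le1 ?(ltW p1)// inv_radial_le1 ?(ltW p1)//.
  set r := (_ - _) / 2; have r1 : r <= 1 by rewrite /r; lra.
  have dE : dip r = inv_dip p.
    rewrite /dip (_ : 3 / 2 - 2 * r = psi (inv_dip p + 2^-1)) ?wE ?addrK//.
    by rewrite /r; field.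
  rewrite radial_le1// stretch_le1// dE; split=> //; first by rewrite /r; lra.
  by rewrite tE; ring.
rewrite inv_radial_ge1//; have a0 := inv_swell_ge0 q p1.
have r1 : 1 <= psi (inv_swell p q) + 3 / 2.
  by have := psi_ge (inv_swell p q); lra.
have aE : swell (psi (inv_swell p q) + 3 / 2) = inv_swell p q.
  by rewrite /swell addrK psiK.
rewrite radial_ge1// stretch_ge1// aE inv_stretch_ge1//.
have a94 : 0 < 9 / 4 + inv_swell p q by lra.
split=> //; first by lra.
  rewrite -[leLHS](ger0_norm q0) -sqrtr_sqr ler_wsqrtr//.
  exact: sqr_le_inv_swell.
(* It remains to see [a * (1 - q ^+ 2 / (9 / 4 + a)) = p - 1], which is [inv_swell_eq] divided by
   [9 / 4 + a]. *)
rewrite expr_div_n sqr_sqrtr ?(ltW a94)//.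
have := inv_swell_eq q p1; set a := inv_swell p q => E.
have a94' : 9 / 4 + a != 0 by rewrite gt_eqF.
have -> : a * (1 - q ^+ 2 / (9 / 4 + a)) =
  a * (9 / 4 + a - q ^+ 2) / (9 / 4 + a).
  by rewrite -mulrA; congr (_ * _); rewrite mulrBl divff.
by rewrite -E mulrAC divff// mul1r addrC subrK.
Qed.

End PlanarMap.

(** * Smoothness along plots *)

Section Plots.
Context {R : realType}.
Local Notation phi := (@phi R).

Section Composites.
Context {E : normedModType R} {D : set E}.
Implicit Types (f : E -> R) (x : E) (k : nat).

Lemma Ck_at_phi_comp k x f : Ck_at D k x f -> Ck_at D k x (fun y => phi (f y)).
Proof. by apply: (@Ck_at_comp R _ _ k x phi f); exact: Ck_at_phi. Qed.

Lemma Ck_at_psi_comp k x f : 0 < f x ->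
  Ck_at D k x f -> Ck_at D k x (fun y => psi (f y)).
Proof. by move=> f0; apply: (@Ck_at_comp R _ _ k x psi f); exact: Ck_at_psi. Qed.

Lemma Ck_at_sqrt_comp k x f : 0 < f x ->
  Ck_at D k x f -> Ck_at D k x (fun y => Num.sqrt (f y)).
Proof. by move=> f0; apply: (@Ck_at_comp R _ _ k x Num.sqrt f); exact: Ck_at_sqrt. Qed.

Lemma Ck_at_inv_comp k x f : f x != 0 ->
  Ck_at D k x f -> Ck_at D k x (fun y => (f y)^-1).
Proof. by move=> f0; apply: (@Ck_at_comp R _ _ k x GRing.inv f); exact: Ck_at_inv. Qed.

End Composites.

Lemma enorm_ge0 k (u : 'rV[R]_k) : 0 <= enorm u.
Proof. exact: sqrtr_ge0. Qed.

Lemma enormZ k (a : R) (u : 'rV[R]_k) : enorm (a *: u) = `|a| * enorm u.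
Proof.
rewrite /enorm -sqrtr_sqr -sqrtrM ?sqr_ge0// mulr_sumr.
by congr Num.sqrt; apply: eq_bigr => i _; rewrite mxE exprMn.
Qed.

Lemma sqr_enorm k (u : 'rV[R]_k) : enorm u ^+ 2 = \sum_(i < k) u ord0 i ^+ 2.
Proof. by rewrite sqr_sqrtr// sumr_ge0// => i _; exact: sqr_ge0. Qed.

Lemma enorm_eq0 k (u : 'rV[R]_k) : enorm u = 0 -> u = 0.
Proof.
move=> u0; have := sqr_enorm u; rewrite u0 expr0n => /esym/psumr_eq0P u0'.
apply/rowP => i; rewrite mxE; apply/eqP; rewrite -sqrf_eq0.
by rewrite u0'// => j _; exact: sqr_ge0.
Qed.

(** The squared norm is polynomial, hence smooth also at 0. For this reason [s] enters [radial] only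
    through its square. *)
Lemma Ck_at_sqr_enorm (d l k : nat) (F : 'rV[R]_d -> 'rV[R]_l) x :
  smooth_at x F -> Ck_at setT k x (fun y => enorm (F y) ^+ 2).
Proof.
move=> sF; rewrite (_ : (fun y => _) =
  fun y => \sum_(i < l) F y ord0 i * F y ord0 i).
  by apply: Ck_at_sum => i; apply: Ck_atM; exact: sF.
by apply/funext => y; rewrite sqr_enorm.
Qed.

Lemma Ck_at_enorm (d l k : nat) (F : 'rV[R]_d -> 'rV[R]_l) x :
  0 < enorm (F x) -> smooth_at x F -> Ck_at setT k x (fun y => enorm (F y)).
Proof.
move=> F0 sF; rewrite (_ : (fun y => _) = fun y => Num.sqrt (enorm (F y) ^+ 2)).
  by apply: Ck_at_sqrt_comp; [rewrite exprn_gt0|exact: Ck_at_sqr_enorm].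
by apply/funext => y; rewrite sqrtr_sqr ger0_norm// enorm_ge0.
Qed.

Lemma smooth_at_near_eq d l (F G : 'rV[R]_d -> 'rV[R]_l) x :
  (\forall y \near x, F y = G y) -> smooth_at x F -> smooth_at x G.
Proof.
move=> FG sF k j; apply: Ck_at_near_eq (sF k j).
by apply: filterS FG => y ->.
Qed.

Lemma smooth_at_continuous d l (F : 'rV[R]_d -> 'rV[R]_l) x :
  smooth_at x F -> {for x, continuous F}.
Proof. by move=> sF; apply/matrix_continuousP => i j; rewrite ord1; exact: (sF 0). Qed.

Lemma smooth_at_id d (x : 'rV[R]_d) : smooth_at x id.
Proof.
move=> k j; case: k => [|k]; first exact: coord_continuous.
split; first exact: coord_continuous.
exists (fun (v : 'rV[R]_d) _ => v ord0 j) => v _; split; last exact: Ck_at_cst.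
near=> y; have dy : derivable (id : 'rV[R]_d -> _) y v by exact: derivable_id.
have := derive_mx dy; rewrite derive_id => /rowP/(_ j); rewrite mxE => ->.
by apply: derivableP; exact: (iffLR (derivable_mxP _ _ _) dy).
Unshelve. all: by end_near. Qed.

Lemma enorm_continuous k : continuous (@enorm R k).
Proof.
move=> u; rewrite (_ : @enorm R k = Num.sqrt \o (fun v => enorm v ^+ 2)).
  apply: continuous_comp; last exact: sqrt_continuous.
  exact: (Ck_at_sqr_enorm 0 (smooth_at_id u)).
by apply/funext => v; rewrite /= sqrtr_sqr ger0_norm// enorm_ge0.
Qed.

(** Plots live on open sets, so diffeological smoothness can be tested on germs of curves and plots
    that stay in [A] near a point. *)
Lemma dsmoothP k l (A : set 'rV[R]_k) (f : 'rV[R]_k -> 'rV[R]_l) :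
  (forall d (c : 'rV[R]_d -> 'rV[R]_k) x, (\forall y \near x, A (c y)) ->
    smooth_at x c -> smooth_at x (f \o c)) -> dsmooth A f.
Proof.
move=> H d U c oU sc cA; apply: smooth_at_smooth_on => x Ux; apply: H; last first.
  exact: smooth_on_smooth_at sc Ux.
have nU : \forall y \near x, U y by exact: open_nbhs_nbhs.
by apply: filterS nU => y Uy; apply: cA; exists y.
Qed.

(** The comparison function [g] may change with the point, so different local formulas can be
    used. *)
Lemma within_continuous_local (T U : topologicalType) (A : set T) (f : T -> U) :
  (forall x, A x -> exists g, {for x, continuous g} /\
    \forall y \near x, A y -> f y = g y) -> {within A, continuous f}.
Proof.
move=> H; apply/subspace_continuousP => x Ax; have [g [cg fg]] := H x Ax.
have E : f x = g x by exact: (nbhs_singleton fg).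
suff : f @ within A (nbhs x) --> g x by rewrite -E.
have cw : g @ within A (nbhs x) --> g x by exact: cvg_within_filter cg.
apply: cvg_trans cw; apply: near_eq_cvg; rewrite near_withinE.
by apply: filterS fg => y gy Ay; rewrite gy.
Qed.

Section Blocks.
Context {n m : nat}.
Implicit Types x : 'rV[R]_(n + m).

Definition scale_blocks (a b : R) x : 'rV[R]_(n + m) :=
  row_mx (a *: lsubmx x) (b *: rsubmx x).

Lemma scale_blocks_comp a b a' b' x :
  scale_blocks a b (scale_blocks a' b' x) = scale_blocks (a * a') (b * b') x.
Proof. by rewrite /scale_blocks row_mxKl row_mxKr !scalerA. Qed.

Lemma scale_blocks1 x : scale_blocks 1 1 x = x.
Proof. by rewrite /scale_blocks !scale1r hsubmxK. Qed.

(** When [u = 0] the factor does not matter; this absorbs the junk value of [radial r s / r] at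
    [r = 0]. *)
Lemma eq_scale_blocks a a' b x : (enorm (lsubmx x) != 0 -> a = a') ->
  scale_blocks a b x = scale_blocks a' b x.
Proof.
move=> aa; rewrite /scale_blocks; congr row_mx.
have [/enorm_eq0 ->|/aa ->//] := eqVneq (enorm (lsubmx x)) 0.
by rewrite !scaler0.
Qed.

Lemma enorm_lscale a b x :
  enorm (lsubmx (scale_blocks a b x)) = `|a| * enorm (lsubmx x).
Proof. by rewrite row_mxKl enormZ. Qed.

Lemma enorm_rscale a b x :
  enorm (rsubmx (scale_blocks a b x)) = `|b| * enorm (rsubmx x).
Proof. by rewrite row_mxKr enormZ. Qed.

Lemma smooth_at_lsubmx d (c : 'rV[R]_d -> 'rV[R]_(n + m)) (x : 'rV[R]_d) :
  smooth_at x c -> smooth_at x (fun y => lsubmx (c y)).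
Proof.
move=> sc k j; rewrite (_ : (fun y => _) = fun y => c y ord0 (lshift m j)).
  exact: sc.
by apply/funext => y; rewrite mxE.
Qed.

Lemma smooth_at_rsubmx d (c : 'rV[R]_d -> 'rV[R]_(n + m)) (x : 'rV[R]_d) :
  smooth_at x c -> smooth_at x (fun y => rsubmx (c y)).
Proof.
move=> sc k j; rewrite (_ : (fun y => _) = fun y => c y ord0 (rshift n j)).
  exact: sc.
by apply/funext => y; rewrite mxE.
Qed.

Lemma smooth_at_scale_blocks d (a b : 'rV[R]_d -> R)
    (c : 'rV[R]_d -> 'rV[R]_(n + m)) (x : 'rV[R]_d) :
  (forall k, Ck_at setT k x a) -> (forall k, Ck_at setT k x b) ->
  smooth_at x c -> smooth_at x (fun y => scale_blocks (a y) (b y) (c y)).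
Proof.
move=> sa sb sc k j; case: (split_ordP j) => i ->.
  rewrite (_ : (fun y => _) = fun y => a y * c y ord0 (lshift m i)).
    by apply: Ck_atM => //; exact: sc.
  by apply/funext => y; rewrite row_mxEl !mxE.
rewrite (_ : (fun y => _) = fun y => b y * c y ord0 (rshift n i)).
  by apply: Ck_atM => //; exact: sc.
by apply/funext => y; rewrite row_mxEr !mxE.
Qed.

Lemma scale_blocks_continuous (a b : 'rV[R]_(n + m) -> R) x :
  {for x, continuous a} -> {for x, continuous b} ->
  {for x, continuous (fun y => scale_blocks (a y) (b y) y)}.
Proof.
move=> ca cb; apply/matrix_continuousP => i0 j.
rewrite (ord1 i0); case: (split_ordP j) => i ->.
  rewrite (_ : (fun y => _) = fun y => a y * y ord0 (lshift m i)).
    by apply: continuousM => //; exact: coord_continuous.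
  by apply/funext => y; rewrite row_mxEl !mxE.
rewrite (_ : (fun y => _) = fun y => b y * y ord0 (rshift n i)).
  by apply: continuousM => //; exact: coord_continuous.
by apply/funext => y; rewrite row_mxEr !mxE.
Qed.

End Blocks.
End Plots.

(** * The map, its inverse, and their smoothness *)

Section Diffeomorphism.
Context {R : realType} {n m : nat}.
Local Notation phi := (@phi R).
Implicit Types x : 'rV[R]_(n + m).

Definition unfold_map x := let r := enorm (lsubmx x) in
  scale_blocks (radial r (enorm (rsubmx x)) / r) (stretch r) x.

Definition fold_map x := let p := enorm (lsubmx x) in let q := enorm (rsubmx x) in
  scale_blocks (inv_radial p q / p) (inv_stretch p q)^-1 x.

Lemma DDE x : DD R n m x = in_domain (enorm (lsubmx x)) (enorm (rsubmx x)).
Proof. by []. Qed.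

Lemma unfold_map_norms x : RnDm R n m x ->
  enorm (lsubmx (unfold_map x)) = radial (enorm (lsubmx x)) (enorm (rsubmx x)) /\
  enorm (rsubmx (unfold_map x)) = enorm (rsubmx x) * stretch (enorm (lsubmx x)).
Proof.
move=> x1; have s01 : 0 <= enorm (rsubmx x) <= 1 by rewrite enorm_ge0.
rewrite enorm_lscale enorm_rscale; split; last first.
  by rewrite ger0_norm 1?mulrC// ltW// stretch_gt0.
have r0 := enorm_ge0 (lsubmx x).
rewrite ger0_norm; last by rewrite divr_ge0// radial_ge0.
have [->|r0'] := eqVneq (enorm (lsubmx x)) 0; last by rewrite divfK.
by rewrite mulr0 radial_near0 ?mulr0.
Qed.

Lemma fold_map_norms x : DD R n m x ->
  enorm (lsubmx (fold_map x)) = inv_radial (enorm (lsubmx x)) (enorm (rsubmx x)) /\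
  enorm (rsubmx (fold_map x)) =
    enorm (rsubmx x) / inv_stretch (enorm (lsubmx x)) (enorm (rsubmx x)).
Proof.
move=> D; have p0 := enorm_ge0 (lsubmx x); have q0 := enorm_ge0 (rsubmx x).
have [r0 _ _ _] := inv_radialK p0 q0 D.
rewrite enorm_lscale enorm_rscale; split; last first.
  by rewrite ger0_norm 1?mulrC// invr_ge0 ltW// inv_stretch_gt0.
rewrite ger0_norm; last by rewrite divr_ge0.
have [E|r0'] := eqVneq (enorm (lsubmx x)) 0; last by rewrite divfK.
move: D; rewrite DDE E mulr0 => D.
by rewrite inv_radial_near0 ?mul0r// ?q0 ?lexx ?ltW ?(in_domain_lt32 D).
Qed.

Lemma unfold_map_DD x : RnDm R n m x -> DD R n m (unfold_map x).
Proof.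
move=> x1; have [E1 E2] := unfold_map_norms x1.
rewrite DDE E1 E2; apply: in_domain_radial; first exact: enorm_ge0.
by rewrite enorm_ge0.
Qed.

Lemma fold_map_RnDm x : DD R n m x -> RnDm R n m (fold_map x).
Proof.
move=> D; rewrite /RnDm/=; have [_ ->] := fold_map_norms D.
have [_ q1 _ _] := inv_radialK (enorm_ge0 _) (enorm_ge0 _) D.
by rewrite ler_pdivrMr ?inv_stretch_gt0// mul1r.
Qed.

Lemma unfold_mapK x : RnDm R n m x -> fold_map (unfold_map x) = x.
Proof.
move=> x1; have [E1 E2] := unfold_map_norms x1.
rewrite /fold_map/= E1 E2.
have s01 : 0 <= enorm (rsubmx x) <= 1 by rewrite enorm_ge0.
have r0 := enorm_ge0 (lsubmx x); have [-> ->] := radialK r0 s01.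
rewrite /unfold_map scale_blocks_comp mulVf ?gt_eqF ?stretch_gt0//.
rewrite -[RHS]scale_blocks1; apply: eq_scale_blocks => r0'.
have rr : 0 < enorm (lsubmx x) by rewrite lt_neqAle eq_sym r0'.
by rewrite mulrA divfK ?divff// radial_neq0.
Qed.

Lemma fold_mapK x : DD R n m x -> unfold_map (fold_map x) = x.
Proof.
move=> D; have [E1 E2] := fold_map_norms D.
have [r0 q1 P1 H1] := inv_radialK (enorm_ge0 _) (enorm_ge0 _) D.
rewrite /unfold_map/= E1 E2 P1 H1 /fold_map scale_blocks_comp.
rewrite mulfV ?gt_eqF ?inv_stretch_gt0//.
rewrite -[RHS]scale_blocks1; apply: eq_scale_blocks => p0.
rewrite mulrA divfK ?divff//; apply: contra_neq p0 => r0'.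
by rewrite -P1 r0' radial_near0 ?mulr0.
Qed.

Lemma ge1_fold_map x : DD R n m x ->
  (1 <= enorm (lsubmx (fold_map x))) = (1 <= enorm (lsubmx x)).
Proof.
move=> D; have [-> _] := fold_map_norms D.
have [_ q1 P1 _] := inv_radialK (enorm_ge0 _) (enorm_ge0 _) D.
apply/idP/idP => [r1|p1].
  rewrite -P1; apply: ge1_radial => //.
  rewrite ler_pdivrMr ?inv_stretch_gt0// mul1r q1 andbT.
  by rewrite divr_ge0 ?enorm_ge0// ltW// inv_stretch_gt0.
rewrite inv_radial_ge1//.
by have := psi_ge (inv_swell (enorm (lsubmx x)) (enorm (rsubmx x))); lra.
Qed.

Lemma unfold_map_SxDm x : SxDm R n m x -> d0SSnm R n m (unfold_map x).
Proof.
move=> [r1 s1]; have [E1 E2] := unfold_map_norms s1.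
split; rewrite ?E1 ?E2 r1.
  by rewrite radial_ge1// swell_le1// mul0r addr0.
rewrite stretch_ge1// swell_le1// addr0 sqrt_9_4; lra.
Qed.

Lemma d0SSnm_DD x : d0SSnm R n m x -> DD R n m x.
Proof.
move=> [p1 _]; rewrite DDE /in_domain p1.
by rewrite lerBlDr lerDl phi_ge0.
Qed.

Lemma fold_map_d0SSnm x : d0SSnm R n m x -> SxDm R n m (fold_map x).
Proof.
move=> D0; have D := d0SSnm_DD D0; split; last exact: fold_map_RnDm.
move: D0 => [p1 q1]; have [-> _] := fold_map_norms D; rewrite p1.
rewrite inv_radial_ge1// psi_le0; first lra.
by rewrite inv_swell_le0// enorm_ge0.
Qed.

Lemma smooth_at_unfold_map d (c : 'rV[R]_d -> 'rV[R]_(n + m)) (z : 'rV[R]_d) :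
  smooth_at z c -> smooth_at z (unfold_map \o c).
Proof.
move=> sc; have sl := smooth_at_lsubmx sc; have sr := smooth_at_rsubmx sc.
have cl : {for z, continuous (fun y => enorm (lsubmx (c y)))}.
  apply: (@continuous_comp _ _ _ (fun y => lsubmx (c y)) (@enorm R n)).
    exact: smooth_at_continuous.
  exact: enorm_continuous.
(* Below 1/4 the map is linear; otherwise [r > 0], so the norm of [u] and its inverse are smooth
   along [c]. *)
have [r4|r4] := ltP (enorm (lsubmx (c z))) 4^-1.
  have nr : \forall y \near z, enorm (lsubmx (c y)) < 4^-1.
    exact: (cl _ (lt_nbhsl r4)).
  apply: smooth_at_near_eq (smooth_at_scale_blocks (a := fun=> 2) (b := fun=> 1)
    _ _ sc); [|by move=> k; exact: Ck_at_cst..].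
  near=> y; have yr : enorm (lsubmx (c y)) < 4^-1 by near: y.
  rewrite /= /unfold_map stretch_near0 ?(ltW yr)//.
  by apply: eq_scale_blocks => y0; rewrite radial_near0 ?(ltW yr)// mulfK.
have r0 : 0 < enorm (lsubmx (c z)) by rewrite (lt_le_trans _ r4).
have sn k : Ck_at setT k z (fun y => enorm (lsubmx (c y))) by exact: Ck_at_enorm.
have sd k : Ck_at setT k z (fun y => dip (enorm (lsubmx (c y)))).
  apply: Ck_atB; last exact: Ck_at_cst.
  by apply/Ck_at_phi_comp/Ck_atB; [exact: Ck_at_cst|exact: Ck_atZ].
have ss k : Ck_at setT k z (fun y => swell (enorm (lsubmx (c y)))).
  by apply/Ck_at_phi_comp/Ck_atB => //; exact: Ck_at_cst.
apply: (smooth_at_scale_blocks _ _ sc) => k.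
  apply: Ck_atM; last by apply: Ck_at_inv_comp => //; rewrite gt_eqF.
  apply: Ck_atD.
    by apply: Ck_atB; [exact: Ck_at_cst|exact: Ck_at_phi_comp].
  apply: Ck_atM => //; apply: Ck_atB; first exact: Ck_at_cst.
  exact: Ck_at_sqr_enorm.
apply: Ck_atD.
  by apply: Ck_atB; [exact/Ck_at_phi_comp/Ck_atN|exact: Ck_at_cst].
apply: Ck_at_sqrt_comp; first by rewrite ltr_pwDl// ?divr_gt0// swell_ge0.
by apply: Ck_atD => //; exact: Ck_at_cst.
Unshelve. all: by end_near. Qed.

(** Three regions: [p < 1/2], where the map is linear; [p < 1], where only [inv_dip] enters; and
    [p >= 1], where the root is positive off [d0SSnm] and [psi] is smooth at it. *)
Lemma smooth_at_fold_map d (c : 'rV[R]_d -> 'rV[R]_(n + m)) (z : 'rV[R]_d) :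
  (\forall y \near z, DD R n m (c y)) -> ~ d0SSnm R n m (c z) ->
  smooth_at z c -> smooth_at z (fold_map \o c).
Proof.
move=> cD nd sc; have sl := smooth_at_lsubmx sc; have sr := smooth_at_rsubmx sc.
have cl : {for z, continuous (fun y => enorm (lsubmx (c y)))}.
  apply: (@continuous_comp _ _ _ (fun y => lsubmx (c y)) (@enorm R n)).
    exact: smooth_at_continuous.
  exact: enorm_continuous.
have cr : {for z, continuous (fun y => enorm (rsubmx (c y)))}.
  apply: (@continuous_comp _ _ _ (fun y => rsubmx (c y)) (@enorm R m)).
    exact: smooth_at_continuous.
  exact: enorm_continuous.
have q32 y : DD R n m y -> enorm (lsubmx y) < 1 -> 0 <= enorm (rsubmx y) <= 3 / 2.
  by move=> D p1; rewrite enorm_ge0 ltW// (in_domain_lt32 D).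
have [p2|p2] := ltP (enorm (lsubmx (c z))) 2^-1.
  have np : \forall y \near z, enorm (lsubmx (c y)) < 2^-1.
    exact: (cl _ (lt_nbhsl p2)).
  apply: smooth_at_near_eq (smooth_at_scale_blocks (a := fun=> 2^-1)
    (b := fun=> 1) _ _ sc); [|by move=> k; exact: Ck_at_cst..].
  near=> y; have yp : enorm (lsubmx (c y)) < 2^-1 by near: y.
  have yD : DD R n m (c y) by near: y.
  have p01 : 0 <= enorm (lsubmx (c y)) <= 2^-1 by rewrite enorm_ge0 ltW.
  have yq : 0 <= enorm (rsubmx (c y)) <= 3 / 2 by apply: q32 => //; lra.
  rewrite /= /fold_map inv_stretch_near0// invr1.
  by apply: eq_scale_blocks => y0; rewrite inv_radial_near0// mulrAC divff// mul1r.
have p0 : 0 < enorm (lsubmx (c z)) by rewrite (lt_le_trans _ p2).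
have sn k : Ck_at setT k z (fun y => enorm (lsubmx (c y))) by exact: Ck_at_enorm.
have [p1|p1] := ltP (enorm (lsubmx (c z))) 1.
  have np : \forall y \near z, enorm (lsubmx (c y)) < 1.
    exact: (cl _ (lt_nbhsl p1)).
  have t2 := inv_dip_gt p1.
  have sd k : Ck_at setT k z (fun y => inv_dip (enorm (lsubmx (c y)))).
    apply: Ck_at_psi_comp; first by rewrite subr_gt0.
    by apply: Ck_atB => //; exact: Ck_at_cst.
  apply: smooth_at_near_eq (smooth_at_scale_blocks
    (a := fun y => (3 / 2 - psi (inv_dip (enorm (lsubmx (c y))) + 2^-1)) / 2 /
                   enorm (lsubmx (c y)))
    (b := fun y => (1 + phi (- inv_dip (enorm (lsubmx (c y)))))^-1) _ _ sc).
  - near=> y; have yp : enorm (lsubmx (c y)) < 1 by near: y.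
    have yD : DD R n m (c y) by near: y.
    have yq := q32 _ yD yp.
    by rewrite /= /fold_map inv_radial_le1 ?(ltW yp)// inv_stretch_le1 ?(ltW yp).
  - move=> k; apply: Ck_atM; last by apply: Ck_at_inv_comp; rewrite ?gt_eqF.
    apply: Ck_atM; last exact: Ck_at_cst.
    apply: Ck_atB; first exact: Ck_at_cst.
    apply: Ck_at_psi_comp; first by lra.
    by apply: Ck_atD => //; exact: Ck_at_cst.
  - move=> k; apply: Ck_at_inv_comp.
      by rewrite gt_eqF// ltr_pwDl// phi_ge0.
    by apply: Ck_atD; [exact: Ck_at_cst|exact/Ck_at_phi_comp/Ck_atN].
have pq : 1 < enorm (lsubmx (c z)) \/
    enorm (lsubmx (c z)) = 1 /\ 3 / 2 < enorm (rsubmx (c z)).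
  move: p1; rewrite le_eqVlt => /predU1P[/esym p1|]; last by left.
  by right; split=> //; rewrite ltNge; apply/negP => q2; exact: nd.
(* If [p = 1] and [q > 3/2], nearby points still have [q > 3/2], and points of the domain with
   [p < 1] have [q < 3/2]. So the plot cannot cross to the inner side. *)
have np : \forall y \near z, 1 <= enorm (lsubmx (c y)).
  case: pq => [p1'|[_ q2]].
    have H : \forall y \near z, 1 < enorm (lsubmx (c y)).
      exact: (cl _ (lt_nbhsr p1')).
    by apply: filterS H => y /ltW.
  have H : \forall y \near z, 3 / 2 < enorm (rsubmx (c y)).
    exact: (cr _ (lt_nbhsr q2)).
  near=> y; rewrite leNgt; apply/negP => yp.
  have yq : 3 / 2 < enorm (rsubmx (c y)) by near: y.
  have yD : DD R n m (c y) by near: y.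
  by have /andP[_] := q32 _ yD yp; rewrite leNgt yq.
have a0 := inv_swell_gt0 pq.
have ss k : Ck_at setT k z
    (fun y => inv_swell (enorm (lsubmx (c y))) (enorm (rsubmx (c y)))).
  have sb : Ck_at setT k z (fun y => 9 / 4 - enorm (rsubmx (c y)) ^+ 2 -
      (enorm (lsubmx (c y)) - 1)).
    apply: Ck_atB; last by apply: Ck_atB => //; exact: Ck_at_cst.
    by apply: Ck_atB; [exact: Ck_at_cst|exact: Ck_at_sqr_enorm].
  apply: Ck_atM; last exact: Ck_at_cst.
  apply: Ck_atD; first exact: Ck_atN.
  apply: Ck_at_sqrt_comp.
    (* The discriminant is positive: through [9 * (p - 1)] if [p > 1], and through
       [(9 / 4 - q ^+ 2) ^+ 2] if [p = 1]. *)
    case: pq => [p1'|[-> q2]].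
      by rewrite ltr_wpDl ?sqr_ge0// mulr_gt0// subr_gt0.
    rewrite subrr mulr0 subr0 addr0 exprn_even_gt0//= lt_eqF//.
    by rewrite subr_lt0; nra.
  apply: Ck_atD; first exact: Ck_atM.
  by apply/Ck_atZ/Ck_atB => //; exact: Ck_at_cst.
apply: smooth_at_near_eq (smooth_at_scale_blocks
  (a := fun y => (psi (inv_swell (enorm (lsubmx (c y))) (enorm (rsubmx (c y)))) +
                  3 / 2) / enorm (lsubmx (c y)))
  (b := fun y => (Num.sqrt (9 / 4 +
     inv_swell (enorm (lsubmx (c y))) (enorm (rsubmx (c y)))))^-1) _ _ sc).
- near=> y; have yp : 1 <= enorm (lsubmx (c y)) by near: y.
  by rewrite /= /fold_map inv_radial_ge1// inv_stretch_ge1.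
- move=> k; apply: Ck_atM; last by apply: Ck_at_inv_comp; rewrite ?gt_eqF.
  by apply: Ck_atD; [exact: Ck_at_psi_comp|exact: Ck_at_cst].
- move=> k; have a94 : 0 < 9 / 4 +
      inv_swell (enorm (lsubmx (c z))) (enorm (rsubmx (c z))).
    by rewrite ltr_wpDl// divr_ge0.
  apply: Ck_at_inv_comp; first by rewrite gt_eqF// sqrtr_gt0.
  apply: Ck_at_sqrt_comp => //.
  by apply: Ck_atD => //; exact: Ck_at_cst.
Unshelve. all: by end_near. Qed.

End Diffeomorphism.

(** * Continuity of the inverse on the whole domain *)

Section Continuity.
Context {R : realType}.

Section FoldContinuity.
Context {n m : nat}.

Lemma fold_map_continuous : {within DD R n m, continuous (@fold_map R n m)}.
Proof.
apply: within_continuous_local => x D.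
have cl : {for x, continuous (fun y : 'rV[R]_(n + m) => enorm (lsubmx y))}.
  apply: (@continuous_comp _ _ _ (fun y => lsubmx y) (@enorm R n)).
    exact: continuous_lsubmx.
  exact: enorm_continuous.
have cr : {for x, continuous (fun y : 'rV[R]_(n + m) => enorm (rsubmx y))}.
  apply: (@continuous_comp _ _ _ (fun y => rsubmx y) (@enorm R m)).
    exact: continuous_rsubmx.
  exact: enorm_continuous.
have cc (a : R) : {for x, continuous (fun=> a : R)} by exact: cst_continuous.
have [p2|p2] := ltP (enorm (lsubmx x)) 2^-1.
  exists (scale_blocks 2^-1 1); split; first exact: scale_blocks_continuous.
  have np : \forall y \near x, enorm (lsubmx y) < 2^-1.
    exact: (cl _ (lt_nbhsl p2)).
  near=> y => yD; have yp : enorm (lsubmx y) < 2^-1 by near: y.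
  have p01 : 0 <= enorm (lsubmx y) <= 2^-1 by rewrite enorm_ge0 ltW.
  have yq : 0 <= enorm (rsubmx y) <= 3 / 2.
    by rewrite enorm_ge0 ltW// (in_domain_lt32 yD)//; lra.
  rewrite /fold_map inv_stretch_near0// invr1.
  by apply: eq_scale_blocks => y0; rewrite inv_radial_near0// mulrAC divff// mul1r.
have p0 : 0 < enorm (lsubmx x) by rewrite (lt_le_trans _ p2).
(* For [p > 0] the global formula is continuous in the ambient space, also at [d0SSnm], because
   [psi] is continuous at 0. *)
exists (@fold_map R n m); split; last by near=> y.
have comp (g : R -> R) (f : 'rV[R]_(n + m) -> R) : continuous g ->
    {for x, continuous f} -> {for x, continuous (fun y => g (f y))}.
  by move=> cg cf; apply: (@continuous_comp _ _ _ f g) => //; exact: cg.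
have cd : {for x, continuous (fun y => inv_dip (enorm (lsubmx y)))}.
  apply: (comp (@psi R)); first exact: psi_continuous.
  exact: (continuousB (cc 1) cl).
have cs : {for x, continuous
    (fun y => psi (inv_swell (enorm (lsubmx y)) (enorm (rsubmx y))))}.
  apply: (comp (@psi R)); first exact: psi_continuous.
  have cb : {for x, continuous (fun y : 'rV[R]_(n + m) =>
      9 / 4 - enorm (rsubmx y) ^+ 2 - (enorm (lsubmx y) - 1))}.
    exact: (continuousB (continuousB (cc (9 / 4)) (continuousM cr cr))
      (continuousB cl (cc 1))).
  apply: continuousM (cc _); apply: continuousD; first exact: (continuousN cb).
  apply: (comp Num.sqrt); first exact: sqrt_continuous.
  exact: (continuousD (continuousM cb cb)
    (continuousM (cc 9) (continuousB cl (cc 1)))).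
apply: scale_blocks_continuous.
  apply: continuousM; last by apply: continuousV => //; rewrite gt_eqF.
  apply: continuousD (cc _); apply: continuousD => //.
  apply: continuousM (cc _); apply: (continuousB (cc (3 / 2))).
  apply: (comp (@psi R)); first exact: psi_continuous.
  exact: (continuousD cd (cc 2^-1)).
apply: continuousV; first by rewrite gt_eqF// inv_stretch_gt0.
apply: continuousD.
  apply: continuousD (cc _); apply: (comp (@phi R)); first exact: phi_continuous.
  exact: (continuousN cd).
apply: (comp Num.sqrt); first exact: sqrt_continuous.
apply: (continuousD (cc (9 / 4))).
by apply: (comp (@phi R)); first exact: phi_continuous.
Unshelve. all: by end_near. Qed.

End FoldContinuity.

(** * The homotopy equivalence of pairs *)

Section Retraction.
Context {n m : nat}.

Definition retract_disk (u : 'rV[R]_n) : 'rV[R]_n := (Num.max 1 (enorm u))^-1 *: u.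

Lemma max1_gt0 (a : R) : 0 < Num.max 1 a.
Proof. by rewrite lt_max ltr01. Qed.

Lemma enorm_retract_disk u : enorm (retract_disk u) = enorm u / Num.max 1 (enorm u).
Proof. by rewrite enormZ ger0_norm 1?mulrC// invr_ge0 ltW// max1_gt0. Qed.

Lemma retract_disk_ge1 u : 1 <= enorm u -> enorm (retract_disk u) = 1.
Proof.
move=> u1; rewrite enorm_retract_disk max_r// divff// gt_eqF//.
exact: lt_le_trans u1.
Qed.

Lemma retract_disk_le1 u : enorm (retract_disk u) <= 1.
Proof.
by rewrite enorm_retract_disk ler_pdivrMr ?max1_gt0// mul1r le_max lexx orbT.
Qed.

Lemma retract_diskK u : enorm u <= 1 -> retract_disk u = u.
Proof. by move=> u1; rewrite /retract_disk max_l// invr1 scale1r. Qed.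

Lemma retract_disk_continuous : continuous retract_disk.
Proof.
move=> u; apply/matrix_continuousP => i j; rewrite (_ : (fun v => _) =
  fun v : 'rV[R]_n => (Num.max 1 (enorm v))^-1 * v i j); last first.
  by apply/funext => v; rewrite mxE.
apply: continuousM; last exact: coord_continuous.
apply: continuousV; first by rewrite gt_eqF// max1_gt0.
apply: (@continuous_comp _ _ _ (@enorm R n) (fun a => Num.max 1 a)).
  exact: enorm_continuous.
by apply: continuous_max; [exact: cst_continuous|exact: cvg_id].
Qed.

(** Forgetting [v] and retracting [u] radially onto the disk is inverse, up to homotopy, to the zero
    section. *)
Lemma pair_homotopy_equivalent_disk :
  pair_homotopy_equivalent (RnDm R n m) (SSxDm R n m) (Disk R n) (Sphere R n).
Proof.
pose g (u : 'rV[R]_n) : 'rV[R]_(n + m) := row_mx u 0.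
pose f (x : 'rV[R]_(n + m)) := retract_disk (lsubmx x).
have e0 k : enorm (0 : 'rV[R]_k) = 0.
  by rewrite /enorm big1 ?sqrtr0// => i _; rewrite mxE expr0n.
have cf : continuous f.
  move=> x; apply: (@continuous_comp _ _ _ (fun y => lsubmx y) retract_disk).
    exact: continuous_lsubmx.
  exact: retract_disk_continuous.
have cg : continuous g.
  move=> u; apply/matrix_continuousP => i j; rewrite (ord1 i).
  case: (split_ordP j) => k ->.
    rewrite (_ : (fun y => _) = fun y : 'rV[R]_n => y ord0 k).
      exact: coord_continuous.
    by apply/funext => y; rewrite row_mxEl.
  rewrite (_ : (fun y => _) = fun=> 0); first exact: cst_continuous.
  by apply/funext => y; rewrite row_mxEr mxE.
exists f, g; split.
- split; first exact: continuous_subspaceT.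
    by move=> _ [x _ <-]; exact: retract_disk_le1.
  by move=> _ [x [x1 _] <-]; exact: retract_disk_ge1.
- split; first exact: continuous_subspaceT.
    by move=> _ [u _ <-]; rewrite /RnDm/= row_mxKr e0.
  by move=> _ [u u1 <-]; rewrite /SSxDm/= row_mxKr row_mxKl e0 u1.
(* The straight line from [g \o f] to the identity. *)
- exists (fun p => row_mx ((1 - p.1) *: f p.2 + p.1 *: lsubmx p.2)
                          (p.1 *: rsubmx p.2)).
  split.
  + apply: continuous_subspaceT => p; apply/matrix_continuousP => i j.
    have c1 : {for p, continuous (fun q : R * 'rV[R]_(n + m) => q.1)}.
      exact: cvg_fst.
    have c2 k : {for p, continuous (fun q : R * 'rV[R]_(n + m) => q.2 ord0 k)}.
      apply: (@continuous_comp _ _ _ snd (fun M : 'rV[R]_(n + m) => M ord0 k)).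
        exact: cvg_snd.
      exact: coord_continuous.
    rewrite (ord1 i); case: (split_ordP j) => k ->.
      rewrite (_ : (fun y => _) = fun q : R * 'rV[R]_(n + m) =>
        (1 - q.1) * f q.2 ord0 k + q.1 * q.2 ord0 (lshift m k)); last first.
        by apply/funext => q; rewrite row_mxEl !mxE.
      apply: continuousD; apply: continuousM => //.
        by apply: continuousB => //; exact: cst_continuous.
      apply: (@continuous_comp _ _ _ snd (fun M : 'rV[R]_(n + m) => f M ord0 k)).
        exact: cvg_snd.
      apply: (@continuous_comp _ _ _ f (fun M : 'rV[R]_n => M ord0 k)).
        exact: cf.
      exact: coord_continuous.
    rewrite (_ : (fun y => _) = fun q : R * 'rV[R]_(n + m) =>
      q.1 * q.2 ord0 (rshift n k)); last first.
      by apply/funext => q; rewrite row_mxEr !mxE.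
    exact: continuousM.
  + move=> x _ /=; split.
      by rewrite subr0 scale1r !scale0r addr0.
    by rewrite subrr scale0r add0r !scale1r hsubmxK.
  + move=> t x /andP[t0 t1] /= x1; rewrite /RnDm/= row_mxKr enormZ ger0_norm//.
    by have := enorm_ge0 (rsubmx x); move: x1; rewrite /RnDm/=; nra.
  + move=> t x /andP[t0 t1] [x1 x2] /=.
    rewrite /SSxDm/= row_mxKr row_mxKl enormZ ger0_norm//; split; last first.
      by have := enorm_ge0 (rsubmx x); nra.
    (* Outside the open unit ball the segment runs along the ray of [u], so its norm is
       [1 - t + t * |u|], at least 1. *)
    rewrite /f /retract_disk max_r// scalerA -scalerDl enormZ.
    have r0 : 0 < enorm (lsubmx x) by exact: lt_le_trans x1.
    have E : ((1 - t) / enorm (lsubmx x) + t) * enorm (lsubmx x) =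
      1 - t + t * enorm (lsubmx x) by rewrite mulrDl divfK// gt_eqF.
    rewrite ger0_norm ?E; first by nra.
    by rewrite addr_ge0// divr_ge0 ?subr_ge0// ltW.
(* [f \o g] is the identity on the disk, so the constant homotopy works. *)
- exists (fun p => f (g p.2)); split.
  + apply: continuous_subspaceT => p.
    apply: (@continuous_comp _ _ _ snd (fun u => f (g u))); first exact: cvg_snd.
    by apply: (@continuous_comp _ _ _ g f); [exact: cg|exact: cf].
  + by move=> u u1 /=; split=> //; rewrite /f row_mxKl retract_diskK.
  + by move=> t u _ _; exact: retract_disk_le1.
  + move=> t u _; rewrite /Sphere/= => u1.
    by rewrite /f /g row_mxKl retract_diskK ?u1.
Qed.

End Retraction.
End Continuity.

Theorem theorem3p6 (R : realType) (n m : nat) (hn : (0 < n)%N) :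
  (exists Phi : 'rV[R]_(n + m) -> 'rV[R]_(n + m),
    [/\ dsmooth (RnDm R n m) Phi,
        homeo (RnDm R n m) (DD R n m) Phi,
        Phi @` (SSxDm R n m) = SSnm R n m,
        Phi @` (SxDm R n m) = d0SSnm R n m &
        diffeo (RnDm R n m `\` SxDm R n m) (DD R n m `\` d0SSnm R n m) Phi])
  /\ pair_homotopy_equivalent (RnDm R n m) (SSxDm R n m) (Disk R n) (Sphere R n).
Proof.
split; last exact: pair_homotopy_equivalent_disk.
have smooth_unfold d (c : 'rV[R]_d -> 'rV[R]_(n + m)) z :
    smooth_at z c -> smooth_at z (unfold_map \o c) by exact: smooth_at_unfold_map.
exists unfold_map; split.
- by apply: dsmoothP => d c z _; exact: smooth_unfold.
- exists fold_map; split.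
  + by move=> _ [x xA <-]; exact: unfold_map_DD.
  + by move=> _ [x xA <-]; exact: fold_map_RnDm.
  + exact: unfold_mapK.
  + exact: fold_mapK.
  + split; last exact: fold_map_continuous.
    apply: continuous_subspaceT => x.
    exact/smooth_at_continuous/(smooth_unfold _ id)/smooth_at_id.
- apply/seteqP; split=> [_ [x [x1 xA] <-]|y y1].
    have yD := unfold_map_DD xA.
    by rewrite /SSnm/= -(ge1_fold_map yD) unfold_mapK.
  have yD : DD R n m y.
    rewrite DDE /in_domain; move: y1; rewrite /SSnm/=.
    by have := phi_ge0 (2 - enorm (lsubmx y) - enorm (rsubmx y)); lra.
  exists (fold_map y); last exact: fold_mapK.
  by split; [rewrite ge1_fold_map|exact: fold_map_RnDm].
- apply/seteqP; split=> [_ [x xA <-]|y yA]; first exact: unfold_map_SxDm.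
  exists (fold_map y); first exact: fold_map_d0SSnm.
  exact/fold_mapK/d0SSnm_DD.
(* Each map sends the exceptional set of its source into that of its target; being mutually inverse,
   they therefore also preserve the complements. *)
- exists fold_map; split.
  + move=> _ [x [xA xS] <-]; split; first exact: unfold_map_DD.
    by move/fold_map_d0SSnm; rewrite unfold_mapK.
  + move=> _ [y [yA yS] <-]; split; first exact: fold_map_RnDm.
    by move/unfold_map_SxDm; rewrite fold_mapK.
  + by move=> x [xA _]; exact: unfold_mapK.
  + by move=> y [yA _]; exact: fold_mapK.
  + split; first by apply: dsmoothP => d c z _; exact: smooth_unfold.
    apply: dsmoothP => d c z cB sc; apply: smooth_at_fold_map => //.
      by apply: filterS cB => y [].
    by have [] := nbhs_singleton cB.
Qed.
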